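(* There is a randomized algorithm with the following guarantee. Let $(P,\mathit{dist})$ be a finite metric space with $N=|P|\ge 2$ points and doubling dimension $d$, where $d$ does not depend on $N$. Given $N$, $d$, and access to $P$ only through a distance oracle that returns $\mathit{dist}(p,q)$ for any $p,q\in P$ in $O(1)$ time, the algorithm outputs the closest-pair distance $\min\{\mathit{dist}(x,y): x,y\in P,\ x\neq y\}$ of $P$, and its expected running time is $O(N\log N)$, where the constant factor in this bound depends only on $d$.
   Context: A metric space $(P,\mathit{dist})$ consists of a non-empty set $P$ and a function $\mathit{dist}:P\times P\to\mathbb{R}$ with $\mathit{dist}(x,x)=0$, $\mathit{dist}(x,y)>0$ for $x\neq y$, $\mathit{dist}(x,y)=\mathit{dist}(y,x)$, and the triangle inequality. For $p\in P$ and $R\ge 0$, $\mathit{ball}_P(p,R)=\{x\in P:\mathit{dist}(p,x)\le R\}$. The doubling dimension of a finite metric space $(P,\mathit{dist})$ is $\log_2\lambda$, where $\lambda$ is the smallest integer such that for every $p\in P$ and every real $R>0$, $\mathit{ball}_P(p,R)$ can be covered by at most $\lambda$ balls $\mathit{ball}_P(q,R/2)$ with centers $q\in P$. Running time is measured in a model where each oracle query and each arithmetic/comparison operation on reals costs $O(1)$. *)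

(* Defs.v *)
From Stdlib Require Import Reals List Arith PeanoNat.
Open Scope R_scope.

Definition is_metric (N : nat) (dist : nat -> nat -> R) : Prop :=
  (forall x, (x < N)%nat -> dist x x = 0) /\
  (forall x y, (x < N)%nat -> (y < N)%nat -> x <> y -> 0 < dist x y) /\
  (forall x y, (x < N)%nat -> (y < N)%nat -> dist x y = dist y x) /\
  (forall x y z, (x < N)%nat -> (y < N)%nat -> (z < N)%nat ->
       dist x z <= dist x y + dist y z).

Definition doubling_covers (N : nat) (dist : nat -> nat -> R) (lam : nat) : Prop :=
  forall p (Rad : R), (p < N)%nat -> 0 < Rad ->
    exists centers : list nat,
      (length centers <= lam)%nat /\
      (forall q, In q centers -> (q < N)%nat) /\
      (forall x, (x < N)%nat -> dist p x <= Rad ->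
         exists q, In q centers /\ dist q x <= Rad / 2).

Definition doubling_constant (N : nat) (dist : nat -> nat -> R) (lam : nat) : Prop :=
  doubling_covers N dist lam /\
  (forall mu, doubling_covers N dist mu -> (lam <= mu)%nat).

Definition doubling_dimension (N : nat) (dist : nat -> nat -> R) (d : R) : Prop :=
  exists lam, doubling_constant N dist lam /\ d = ln (INR lam) / ln 2.

Definition is_closest_pair_distance (N : nat) (dist : nat -> nat -> R) (r : R) : Prop :=
  (exists x y, (x < N)%nat /\ (y < N)%nat /\ x <> y /\ dist x y = r) /\
  (forall x y, (x < N)%nat -> (y < N)%nat -> x <> y -> r <= dist x y).

(** * A randomized real-RAM with a distance oracle (unit cost per instruction) *)

Inductive instr : Type :=
  (* integer registers/memory NM, real registers/memory RM *)
  | NConst (a c : nat)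
  | NAdd (a b c : nat)
  | NSub (a b c : nat)          (* truncated subtraction *)
  | NMul (a b c : nat)
  | NDiv (a b c : nat)          (* floor division (x/0 = 0) *)
  | NMod (a b c : nat)
  | NLoad (a b : nat)
  | NStore (a b : nat)
  | NRand (a : nat)
  | RofN (a b : nat)
  | RLoad (a b : nat)
  | RStore (a b : nat)
  | RAdd (a b c : nat)
  | RSub (a b c : nat)
  | RMul (a b c : nat)
  | RDiv (a b c : nat)
  | RQuery (a b c : nat)
  | Jmp (l : nat)
  | JNLt (a b l : nat)
  | JNEq (a b l : nat)
  | JRLt (a b l : nat)
  | JREq (a b l : nat)
  | Halt.

Record config : Type := mkConfig {
  pc : nat;
  nmem : nat -> nat;
  rmem : nat -> R
}.

Definition updn (m : nat -> nat) (a v : nat) : nat -> nat :=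
  fun i => if Nat.eqb i a then v else m i.
Definition updr (m : nat -> R) (a : nat) (v : R) : nat -> R :=
  fun i => if Nat.eqb i a then v else m i.

Definition halted (prog : list instr) (c : config) : bool :=
  match nth_error prog (pc c) with
  | None => true
  | Some Halt => true
  | Some _ => false
  end.

Definition oracle (N : nat) (dist : nat -> nat -> R) (i j : nat) : R :=
  if andb (Nat.ltb i N) (Nat.ltb j N) then dist i j else 0.

Definition step (prog : list instr) (orc : nat -> nat -> R) (bit : bool)
  (c : config) : config :=
  let n := nmem c in let r := rmem c in let p := pc c in
  let nx := S p in
  let setn a v := mkConfig nx (updn n a v) r in
  let setr a v := mkConfig nx n (updr r a v) in
  match nth_error prog p with
  | None => c
  | Some i =>
    match i with
    | Halt => c
    | NConst a k => setn a k
    | NAdd a b d => setn a (n b + n d)%nat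
    | NSub a b d => setn a (n b - n d)%nat
    | NMul a b d => setn a (n b * n d)%nat
    | NDiv a b d => setn a (Nat.div (n b) (n d))
    | NMod a b d => setn a (Nat.modulo (n b) (n d))
    | NLoad a b => setn a (n (n b))
    | NStore a b => setn (n a) (n b)
    | NRand a => setn a (if bit then 1%nat else 0%nat)
    | RofN a b => setr a (INR (n b))
    | RLoad a b => setr a (r (n b))
    | RStore a b => setr (n a) (r b)
    | RAdd a b d => setr a (r b + r d)
    | RSub a b d => setr a (r b - r d)
    | RMul a b d => setr a (r b * r d)
    | RDiv a b d => setr a (r b / r d)
    | RQuery a b d => setr a (orc (n b) (n d))
    | Jmp l => mkConfig l n r
    | JNLt a b l => mkConfig (if Nat.ltb (n a) (n b) then l else nx) n r
    | JNEq a b l => mkConfig (if Nat.eqb (n a) (n b) then l else nx) n r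
    | JRLt a b l =>
        mkConfig (if Rlt_dec (r a) (r b) then l else nx) n r
    | JREq a b l =>
        mkConfig (if Req_EM_T (r a) (r b) then l else nx) n r
    end
  end.

Definition init_config (N : nat) (d : R) : config :=
  mkConfig 0 (fun i => if Nat.eqb i 0 then N else 0%nat)
             (fun i => if Nat.eqb i 0 then d else 0).

Fixpoint run (prog : list instr) (orc : nat -> nat -> R) (bits : nat -> bool)
  (t : nat) (c : config) : config :=
  match t with
  | O => c
  | S t' => step prog orc (bits t') (run prog orc bits t' c)
  end.

Fixpoint bitlists (k : nat) : list (list bool) :=
  match k with
  | O => nil :: nil
  | S k' => map (cons true) (bitlists k') ++ map (cons false) (bitlists k')
  end.

Definition bits_of (l : list bool) : nat -> bool := fun i => nth i l false.

Definition final_config (prog : list instr) (N : nat) (dist : nat -> nat -> R)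
  (d : R) (l : list bool) : config :=
  run prog (oracle N dist) (bits_of l) (length l) (init_config N d).

Definition prob_time_gt (prog : list instr) (N : nat) (dist : nat -> nat -> R)
  (d : R) (k : nat) : R :=
  INR (length (filter (fun l => negb (halted prog (final_config prog N dist d l)))
                      (bitlists k))) / 2 ^ k.

Fixpoint psum (f : nat -> R) (K : nat) : R :=
  match K with O => 0 | S K' => psum f K' + f K' end.

(* Main.v *)
(* Divide and conquer with random separators.  The program keeps a queue of
   subsets ("items") one of which contains a closest pair unless the smallest
   distance seen so far is already optimal.  For an item of n points it draws
   random points p, q and a random annulus among T equally wide ones between the
   spheres of radius R = dist p q and 2 R around p, and replaces the item by the
   points inside the outer sphere and the points outside the inner sphere of the
   annulus, provided that both parts are smaller by a constant factor and that
   the annulus has at most 2 n / T points.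

   A trial succeeds with probability bounded below in terms of the doubling
   constant: p may be any point of the densest ball of radius r holding 2 m points,
   with m = n / (4 L ^ 4), q any point of large enough rank among the points at
   distance at most 2 r from p, and then at least half of the annuli are sparse.
   A closest pair is not separated, because by packing the more than L ^ (s + 2)
   points within 2 R of p cannot all be further apart than the width R / T, where
   T = 2 ^ s.  As T is at least of order log n, the duplicated points do not spoil
   the potential n (1 + ln n).  When n is too small for these choices, its size is
   bounded in terms of the dimension and all pairs are compared. *)

Require Import Defs.
From Stdlib Require Import Reals List Arith Lia Lra Psatz.
Import ListNotations.
Open Scope bool_scope.
Open Scope R_scope.

(** * Expected cost of a randomized computation *)

Section ExpectedCost.

Variable prog : list instr.
Variable orc : nat -> nat -> R.
Variable Post : R -> Prop.

(* Weakest-preexpectation style invariant, cut off after [K] steps: [v] bounds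
   the expected number of steps still to be made, and every halting
   continuation of length at most [K] leaves a correct answer in real cell 0. *)
Fixpoint ecost (K : nat) (c : config) (v : R) : Prop :=
  (halted prog c = true -> Post (rmem c 0)) /\ 0 <= v /\
  match K with
  | O => True
  | S K' => halted prog c = true \/
      exists v1 v2, 1 + (v1 + v2) / 2 <= v /\
        ecost K' (step prog orc true c) v1 /\ ecost K' (step prog orc false c) v2
  end.

Lemma ecost_post K c v : ecost K c v -> halted prog c = true -> Post (rmem c 0).
Proof. destruct K; simpl; tauto. Qed.

Lemma ecost_nonneg K c v : ecost K c v -> 0 <= v.
Proof. destruct K; simpl; tauto. Qed.

Lemma ecost_weaken K c v w : ecost K c v -> v <= w -> ecost K c w.
Proof.
  destruct K; simpl; intros (H & H0 & H1) Hw; (repeat split); auto; try lra.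
  destruct H1 as [H1 | (v1 & v2 & H1 & H2 & H3)]; auto.
  right. exists v1, v2. split; [lra | auto].
Qed.

Lemma ecost_pred K c v : ecost (S K) c v -> ecost K c v.
Proof.
  revert c v; induction K as [|K IH]; intros c v (H & H0 & H1).
  - simpl; auto.
  - split; [exact H | split; [exact H0 |]].
    destruct H1 as [H1 | (v1 & v2 & H1 & H2 & H3)]; [left; exact H1 | right].
    exists v1, v2; auto.
Qed.

Lemma halted_step c b : halted prog c = true -> step prog orc b c = c.
Proof.
  unfold halted, step. destruct (nth_error prog (pc c)) as [i|]; auto.
  destruct i; auto; discriminate.
Qed.

Lemma halted_run c t bits : halted prog c = true -> run prog orc bits t c = c.
Proof.
  intro H; induction t as [|t IH]; simpl; auto.
  rewrite IH. apply halted_step, H.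
Qed.

(** [run] peels off the last step, whereas [ecost] branches on the first coin. *)
Lemma run_S bits t c :
  run prog orc bits (S t) c =
  run prog orc (fun i => bits (S i)) t (step prog orc (bits 0%nat) c).
Proof.
  induction t as [|t IH]; auto.
  change (run prog orc bits (S (S t)) c)
    with (step prog orc (bits (S t)) (run prog orc bits (S t) c)).
  rewrite IH. reflexivity.
Qed.

Lemma run_bits_cons b l c :
  run prog orc (bits_of (b :: l)) (length (b :: l)) c =
  run prog orc (bits_of l) (length l) (step prog orc b c).
Proof. apply run_S. Qed.

Lemma ecost_correct l c v :
  ecost (length l) c v ->
  halted prog (run prog orc (bits_of l) (length l) c) = true ->
  Post (rmem (run prog orc (bits_of l) (length l) c) 0).
Proof.
  revert c v; induction l as [|b l IH]; intros c v H Hh.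
  - exact (ecost_post _ _ _ H Hh).
  - rewrite run_bits_cons in *.
    destruct H as (H & H0 & [H1 | (v1 & v2 & H1 & H2 & H3)]).
    + rewrite halted_step by exact H1. rewrite halted_run by exact H1. auto.
    + destruct b; eauto.
Qed.

Definition running (c : config) (k : nat) : nat :=
  length (filter
    (fun l => negb (halted prog (run prog orc (bits_of l) (length l) c)))
    (bitlists k)).

(** Conditioning on the first coin. *)
Lemma running_S c k :
  running c (S k) =
  (running (step prog orc true c) k + running (step prog orc false c) k)%nat.
Proof.
  unfold running. cbn [bitlists]. rewrite filter_app, length_app.
  assert (E : forall b ll,
    length (filter (fun l => negb (halted prog (run prog orc (bits_of l) (length l) c)))
              (map (cons b) ll)) =
    length (filter (fun l => negb (halted prog
              (run prog orc (bits_of l) (length l) (step prog orc b c)))) ll)).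
  { intros b ll; induction ll as [|l ll IH]; auto.
    cbn [map filter]. rewrite run_bits_cons.
    destruct (negb _); cbn [length]; rewrite IH; auto. }
  rewrite !E. reflexivity.
Qed.

Lemma psum_ext f g K : (forall k, (k < K)%nat -> f k = g k) -> psum f K = psum g K.
Proof.
  induction K as [|K IH]; intro H; simpl; auto.
  rewrite IH, H; auto.
Qed.

Lemma psum_shift f K : psum f (S K) = f 0%nat + psum (fun k => f (S k)) K.
Proof.
  induction K as [|K IH]; simpl; [lra |]. simpl in IH. rewrite IH. lra.
Qed.

Lemma psum_average f g K :
  psum (fun k => (f k + g k) / 2) K = (psum f K + psum g K) / 2.
Proof. induction K as [|K IH]; simpl; [| rewrite IH]; lra. Qed.

Lemma psum_zero f K : (forall k, f k = 0) -> psum f K = 0.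
Proof. intro H; induction K as [|K IH]; simpl; auto. rewrite IH, H; lra. Qed.

(** The sum is the expectation of the running time truncated at [K], written by tail probabilities.
    Its term for k = 0 is at most 1, and by [running_S] the others average the two successors, which
    is the recursion of [ecost]. *)
Lemma ecost_expectation K c v :
  ecost K c v -> psum (fun k => INR (running c k) / 2 ^ k) K <= v.
Proof.
  revert c v; induction K as [|K IH]; intros c v H.
  - simpl. exact (ecost_nonneg _ _ _ H).
  - destruct H as (_ & H0 & [Hh | (v1 & v2 & H1 & H2 & H3)]).
    + rewrite psum_zero; auto. intro k.
      replace (running c k) with 0%nat; [simpl; unfold Rdiv; ring |].
      unfold running. symmetry. induction (bitlists k) as [|l ll IHl]; auto.
      simpl. rewrite halted_run, Hh by auto. exact IHl.
    + rewrite psum_shift.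
      rewrite (psum_ext _ (fun k =>
        (INR (running (step prog orc true c) k) / 2 ^ k +
         INR (running (step prog orc false c) k) / 2 ^ k) / 2)).
      2: { intros k _. rewrite running_S, plus_INR. simpl.
           field. apply pow_nonzero; lra. }
      rewrite psum_average.
      pose proof (IH _ _ H2). pose proof (IH _ _ H3).
      assert (INR (running c 0) / 2 ^ 0 <= 1).
      { unfold running. simpl. destruct (negb _); simpl; lra. }
      lra.
Qed.

Lemma ecost_step_later K c v :
  halted prog c = false ->
  (forall b, ecost K (step prog orc b c) (v - 1)) -> ecost (S K) c v.
Proof.
  intros Hh H. split; [congruence |].
  pose proof (ecost_nonneg _ _ _ (H true)).
  split; [lra |]. right. exists (v - 1), (v - 1). split; [lra | auto].
Qed.

(** Keeping the cut-off [K], as [ecost_pred] allows, spares straight-line code and bounded loops any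
    bookkeeping. Only the heads of [trial_loop] and [main_loop], proved by induction on [K], lower
    it through [ecost_step_later]. *)
Lemma ecost_step K c v :
  halted prog c = false ->
  (forall b, ecost K (step prog orc b c) (v - 1)) -> ecost K c v.
Proof. intros. apply ecost_pred, ecost_step_later; auto. Qed.

Lemma ecost_coin K c v v1 v2 :
  halted prog c = false -> 1 + (v1 + v2) / 2 <= v ->
  ecost K (step prog orc true c) v1 -> ecost K (step prog orc false c) v2 ->
  ecost K c v.
Proof.
  intros Hh Hv H1 H2. apply ecost_pred. split; [congruence |].
  pose proof (ecost_nonneg _ _ _ H1). pose proof (ecost_nonneg _ _ _ H2).
  split; [lra |]. right. exists v1, v2; auto.
Qed.

Lemma ecost_halt K c v :
  halted prog c = true -> Post (rmem c 0) -> 0 <= v -> ecost K c v.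
Proof. intros. destruct K; simpl; auto. Qed.

End ExpectedCost.

(** * Counting *)

Lemma doubling_covers_mono N dist lam L :
  (lam <= L)%nat -> doubling_covers N dist lam -> doubling_covers N dist L.
Proof.
  intros H HD p Rad Hp HR. destruct (HD p Rad Hp HR) as (cs & Hl & H1).
  exists cs. split; [lia | auto].
Qed.

Lemma filter_length_impl {A} (f g : A -> bool) l :
  (forall x, In x l -> f x = true -> g x = true) ->
  (length (filter f l) <= length (filter g l))%nat.
Proof.
  induction l as [|x l IH]; intro H; simpl; auto.
  assert (IH' := IH (fun y Hy => H y (or_intror Hy))).
  destruct (f x) eqn:E.
  - rewrite (H x (or_introl eq_refl) E). simpl. lia.
  - destruct (g x); simpl; lia.
Qed.

Lemma filter_negb_length {A} (f : A -> bool) l :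
  (length (filter f l) + length (filter (fun x => negb (f x)) l) = length l)%nat.
Proof. induction l as [|x l IH]; simpl; auto. destruct (f x); simpl; lia. Qed.

Lemma filter_andb_negb_length {A} (f g : A -> bool) l :
  (length (filter (fun x => f x && g x) l) +
   length (filter (fun x => f x && negb (g x)) l) = length (filter f l))%nat.
Proof.
  induction l as [|x l IH]; simpl; auto.
  destruct (f x); simpl; auto. destruct (g x); simpl; lia.
Qed.

Lemma minimiser {A} (f : A -> R) (P : A -> bool) (l : list A) :
  (exists a, In a l /\ P a = true) ->
  exists a, In a l /\ P a = true /\ forall b, In b l -> P b = true -> f a <= f b.
Proof.
  induction l as [|x l IH]; intros (a & Ha & Pa); [destruct Ha |].
  destruct (Exists_dec (fun b => P b = true) l (fun b => Bool.bool_dec _ _)) as [E|E].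
  - apply Exists_exists in E. destruct (IH E) as (b & Hb & Pb & Hmin).
    destruct (P x) eqn:Px.
    + destruct (Rle_dec (f x) (f b)).
      * exists x; repeat split; simpl; auto. intros c [->|Hc] Pc; [lra |].
        specialize (Hmin c Hc Pc); lra.
      * exists b; repeat split; simpl; auto. intros c [->|Hc] Pc; [lra | auto].
    + exists b; repeat split; simpl; auto. intros c [->|Hc] Pc; [congruence | auto].
  - assert (Hn : forall b, In b l -> P b = true -> False).
    { intros b Hb Pb. apply E, Exists_exists. eauto. }
    destruct Ha as [<-|Ha]; [| destruct (Hn _ Ha Pa)].
    exists x; repeat split; simpl; auto. intros c [->|Hc] Pc; [lra | destruct (Hn _ Hc Pc)].
Qed.

Lemma filter_filter_length {A} (f g : A -> bool) l :
  (length (filter f (filter g l)) <= length (filter f l))%nat.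
Proof.
  induction l as [|x l IH]; simpl; auto.
  destruct (g x); simpl; destruct (f x); simpl; lia.
Qed.

Lemma cover_count {A B} (P : B -> A -> bool) (k : nat) (cs : list B) (l : list A) :
  (forall x, In x l -> exists q, In q cs /\ P q x = true) ->
  (forall q, In q cs -> (length (filter (P q) l) <= k)%nat) ->
  (length l <= length cs * k)%nat.
Proof.
  revert l; induction cs as [|q cs IH]; intros l H Hk.
  - destruct l as [|x l]; simpl; [lia |].
    destruct (H x (or_introl eq_refl)) as (? & [] & _).
  - rewrite <- (filter_negb_length (P q) l).
    pose proof (Hk q (or_introl eq_refl)).
    assert (length (filter (fun x => negb (P q x)) l) <= length cs * k)%nat.
    { apply IH.
      - intros x Hx. apply filter_In in Hx. destruct Hx as [Hx Hn].
        destruct (H x Hx) as (c & [<-|Hc] & HP); [| eauto].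
        rewrite HP in Hn; discriminate.
      - intros c Hc. eapply Nat.le_trans; [| apply (Hk c (or_intror Hc))].
        apply filter_filter_length. }
    simpl; lia.
Qed.

(** * Sums of natural numbers *)

Fixpoint nsum (f : nat -> nat) (n : nat) : nat :=
  match n with O => O | S n' => (nsum f n' + f n')%nat end.

Lemma nsum_shift f n : nsum f (S n) = (f O + nsum (fun i => f (S i)) n)%nat.
Proof. induction n as [|n IH]; simpl in *; lia. Qed.

Lemma nsum_le f g n :
  (forall i, (i < n)%nat -> (f i <= g i)%nat) -> (nsum f n <= nsum g n)%nat.
Proof.
  induction n as [|n IH]; intro H; simpl; auto.
  specialize (H n (Nat.lt_succ_diag_r n)) as Hn.
  assert (nsum f n <= nsum g n)%nat by (apply IH; auto). lia.
Qed.

Lemma nsum_ext f g n :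
  (forall i, (i < n)%nat -> f i = g i) -> nsum f n = nsum g n.
Proof. induction n as [|n IH]; intro H; simpl; auto. rewrite IH, H; auto. Qed.

Lemma nsum_add f m n : nsum f (m + n) = (nsum f m + nsum (fun i => f (m + i)) n)%nat.
Proof.
  induction n as [|n IH]; simpl; [rewrite Nat.add_0_r; lia |].
  rewrite Nat.add_succ_r. simpl. lia.
Qed.

Lemma nsum_prod f a b :
  nsum f (a * b) = nsum (fun y => nsum (fun x => f (x + a * y)) a)%nat b.
Proof.
  induction b as [|b IH]; simpl; [rewrite Nat.mul_0_r; auto |].
  rewrite Nat.mul_succ_r, nsum_add, IH. f_equal.
  apply nsum_ext; intros; f_equal; lia.
Qed.

Lemma nsum_mul_l k f n : nsum (fun i => k * f i)%nat n = (k * nsum f n)%nat.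
Proof. induction n as [|n IH]; simpl; lia. Qed.

Lemma nsum_mono_n f m n : (m <= n)%nat -> (nsum f m <= nsum f n)%nat.
Proof. induction 1; simpl; lia. Qed.

(** Points are drawn by their index below a power of two [B]; the indices beyond the list are
    wasted, but contribute nothing negative. *)
Lemma nsum_ge_filter (g : nat -> bool) (f : nat -> nat) (a B : nat) (l : list nat) :
  (length l <= B)%nat ->
  (forall i, (i < length l)%nat -> g (nth i l O) = true -> (a <= f i)%nat) ->
  (a * length (filter g l) <= nsum f B)%nat.
Proof.
  intros HB H. eapply Nat.le_trans; [| apply nsum_mono_n, HB]. clear HB.
  revert f H; induction l as [|x l IH]; intros f H.
  - simpl. lia.
  - cbn [length]. rewrite nsum_shift.
    assert (IH' : (a * length (filter g l) <= nsum (fun i => f (S i)) (length l))%nat).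
    { apply IH. intros i Hi. apply (H (S i)). simpl; lia. }
    pose proof (H O) as H0. simpl in H0 |- *.
    destruct (g x); simpl; [specialize (H0 (Nat.lt_0_succ _) eq_refl) |]; lia.
Qed.

(* Markov's inequality for the increments of a monotone counter. *)
Lemma few_large_increments (c : nat -> nat) (n T : nat) :
  (1 <= n)%nat -> (forall k, (c k <= c (S k))%nat) -> (c T <= n)%nat ->
  (T <= 2 * nsum (fun k => if (c (S k) - c k) * T <=? 2 * n then 1 else 0) T)%nat.
Proof.
  intros Hn1 Hm Hn.
  set (small := fun k => ((c (S k) - c k) * T <=? 2 * n)%nat).
  (* Each step raises the left side by 2 n. A large increment pays for it in the first summand, a
     small one by its indicator. *)
  assert (E : forall t,
    (2 * n * t <= T * (c t - c O) + 2 * n * nsum (fun k => if small k then 1 else 0) t)%nat).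
  { induction t as [|t IH]; [simpl; lia |]. cbn [nsum].
    assert (c O <= c t)%nat by (clear - Hm; induction t; [lia | specialize (Hm t); lia]).
    specialize (Hm t).
    replace (c (S t) - c O)%nat with ((c (S t) - c t) + (c t - c O))%nat by lia.
    rewrite !Nat.mul_add_distr_l, Nat.mul_succ_r. unfold small at 2.
    destruct (_ <=? _)%nat eqn:E; [| apply Nat.leb_gt in E];
      pose proof (Nat.le_0_l (T * (c (S t) - c t))); lia. }
  specialize (E T).
  assert (T * (c T - c O) <= T * n)%nat by (apply Nat.mul_le_mono_l; lia).
  change (T <= 2 * nsum (fun k => if small k then 1 else 0) T)%nat.
  apply (Nat.mul_le_mono_pos_l _ _ n); lia.
Qed.

Lemma div_mod_digits b x y :
  (x < b)%nat -> ((x + b * y) mod b = x /\ (x + b * y) / b = y)%nat.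
Proof.
  intro H. rewrite (Nat.mul_comm b), Nat.Div0.mod_add, Nat.div_add by lia.
  rewrite Nat.mod_small, Nat.div_small by lia. lia.
Qed.

(** * Balls in a doubling metric *)

Section Doubling.

Variables (N : nat) (dist : nat -> nat -> R) (L : nat).
Hypothesis metric : is_metric N dist.
Hypothesis covers : doubling_covers N dist L.

Let dist0 x : (x < N)%nat -> dist x x = 0.
Proof. apply metric. Qed.
Let dist_pos x y : (x < N)%nat -> (y < N)%nat -> x <> y -> 0 < dist x y.
Proof. apply metric. Qed.
Let dist_sym x y : (x < N)%nat -> (y < N)%nat -> dist x y = dist y x.
Proof. apply metric. Qed.
Let dist_tri x y z : (x < N)%nat -> (y < N)%nat -> (z < N)%nat ->
  dist x z <= dist x y + dist y z.
Proof. apply metric. Qed.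

Lemma dist_nonneg x y : (x < N)%nat -> (y < N)%nat -> 0 <= dist x y.
Proof.
  intros Hx Hy. destruct (Nat.eq_dec x y) as [->|E]; [rewrite dist0; auto; lra |].
  apply Rlt_le; auto.
Qed.

Lemma iterated_cover j p Rad :
  (p < N)%nat -> 0 < Rad ->
  exists cs, (length cs <= L ^ j)%nat /\ (forall q, In q cs -> (q < N)%nat) /\
    forall x, (x < N)%nat -> dist p x <= Rad ->
      exists q, In q cs /\ dist q x <= Rad / 2 ^ j.
Proof.
  revert p Rad; induction j as [|j IH]; intros p Rad Hp HR.
  - exists (p :: nil). simpl. repeat split; [lia | intros q [<-|[]]; auto |].
    intros x Hx H. exists p. split; [auto | lra].
  - destruct (IH p Rad Hp HR) as (cs & Hl & Hc & Hx).
    assert (HR' : 0 < Rad / 2 ^ j) by (apply Rdiv_lt_0_compat; [auto | apply pow_lt; lra]).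
    assert (E : forall ds, (forall q, In q ds -> (q < N)%nat) ->
      exists es, (length es <= length ds * L)%nat /\ (forall q, In q es -> (q < N)%nat) /\
        forall x q, (x < N)%nat -> In q ds -> dist q x <= Rad / 2 ^ j ->
          exists q', In q' es /\ dist q' x <= Rad / 2 ^ j / 2).
    { induction ds as [|q ds IHd]; intro Hd.
      - exists nil. simpl. repeat split; [lia | intros ? [] | intros ? ? ? []].
      - destruct IHd as (es & E1 & E2 & E3); [intros; apply Hd; simpl; auto |].
        destruct (covers q (Rad / 2 ^ j)) as (fs & F1 & F2 & F3); [apply Hd; simpl; auto | auto |].
        exists (fs ++ es). rewrite length_app. simpl. repeat split; [lia | |].
        + intros z Hz. apply in_app_or in Hz. destruct Hz; auto.
        + intros x z Hxx [<-|Hz] Hdz.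
          * destruct (F3 x Hxx Hdz) as (q' & ? & ?). exists q'. split; auto. apply in_or_app; auto.
          * destruct (E3 x z Hxx Hz Hdz) as (q' & ? & ?). exists q'. split; auto. apply in_or_app; auto. }
    destruct (E cs Hc) as (es & E1 & E2 & E3).
    exists es. repeat split; [simpl; nia | auto |].
    intros x Hxx Hd. destruct (Hx x Hxx Hd) as (q & Hq & Hdq).
    destruct (E3 x q Hxx Hq Hdq) as (q' & Hq' & Hd').
    exists q'. split; auto. simpl.
    replace (Rad / (2 * 2 ^ j)) with (Rad / 2 ^ j / 2); auto.
    field. apply pow_nonzero; lra.
Qed.

(* Phrased with [Rlt_dec] because that is the test made by [JRLt]. *)
Definition within (p : nat) (rho : R) (x : nat) : bool :=
  if Rlt_dec rho (dist p x) then false else true.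

Lemma within_spec p rho x : within p rho x = true <-> dist p x <= rho.
Proof. unfold within. destruct (Rlt_dec _ _); split; intros; auto; try lra; discriminate. Qed.

Lemma within_false p rho x : within p rho x = false <-> rho < dist p x.
Proof. unfold within. destruct (Rlt_dec _ _); split; intros; auto; try lra; discriminate. Qed.

(** After j halvings the covering balls have radius at most w / 2, so by the triangle inequality
    each holds at most one point of [l]. *)
Lemma packing p rho w j (l : list nat) :
  (p < N)%nat -> 0 < rho -> NoDup l ->
  (forall x, In x l -> (x < N)%nat) ->
  (forall x, In x l -> dist p x <= rho) ->
  (forall x y, In x l -> In y l -> x <> y -> w < dist x y) ->
  2 * rho <= w * 2 ^ j -> (length l <= L ^ j)%nat.
Proof.
  intros Hp Hr Hnd Hl Hd Hw Hj.
  destruct (iterated_cover j p rho Hp Hr) as (cs & C1 & C2 & C3).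
  assert (H2j : 0 < 2 ^ j) by (apply pow_lt; lra).
  assert (Hb : rho / 2 ^ j <= w / 2).
  { apply Rmult_le_reg_r with (2 ^ j); auto.
    unfold Rdiv. rewrite Rmult_assoc, Rinv_l by lra. lra. }
  enough (length l <= length cs * 1)%nat by lia.
  apply (cover_count (fun q x => within q (rho / 2 ^ j) x)).
  - intros x Hx. destruct (C3 x (Hl x Hx) (Hd x Hx)) as (q & Hq & Hdq).
    exists q. split; auto. apply within_spec, Hdq.
  - intros q Hq.
    assert (Hnd' : NoDup (filter (within q (rho / 2 ^ j)) l)) by (apply NoDup_filter, Hnd).
    destruct (filter _ l) as [|x [|y k]] eqn:E; simpl; try lia.
    exfalso.
    assert (Hx : In x (filter (within q (rho / 2 ^ j)) l)) by (rewrite E; simpl; auto).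
    assert (Hy : In y (filter (within q (rho / 2 ^ j)) l)) by (rewrite E; simpl; auto).
    apply filter_In in Hx, Hy. destruct Hx as [Hx Hxd], Hy as [Hy Hyd].
    apply within_spec in Hxd, Hyd.
    assert (Hxy : x <> y) by (inversion Hnd'; subst; simpl in *; intuition).
    pose proof (Hw x y Hx Hy Hxy).
    pose proof (dist_tri x q y (Hl x Hx) (C2 q Hq) (Hl y Hy)) as Ht.
    rewrite (dist_sym x q) in Ht by auto. lra.
Qed.

(** * Balanced balls *)

Variable l : list nat.
Hypothesis l_lt : forall x, In x l -> (x < N)%nat.
Hypothesis l_nodup : NoDup l.

Definition ball_count (p : nat) (rho : R) : nat := length (filter (within p rho) l).

Lemma ball_count_mono p rho rho' :
  rho <= rho' -> (ball_count p rho <= ball_count p rho')%nat.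
Proof.
  intro H. apply filter_length_impl. intros x _ Hx.
  apply within_spec. apply within_spec in Hx. lra.
Qed.

Lemma ball_count_le p rho : (ball_count p rho <= length l)%nat.
Proof. apply filter_length_le. Qed.

Lemma farthest_within p rho :
  (1 <= ball_count p rho)%nat ->
  exists x, In x l /\ dist p x <= rho /\
    forall y, In y l -> dist p y <= rho -> dist p y <= dist p x.
Proof.
  intro H. destruct (minimiser (fun x => - dist p x) (within p rho) l) as (x & Hx & Wx & Hm).
  - unfold ball_count in H. destruct (filter _ l) as [|x k] eqn:E; [simpl in H; lia |].
    exists x. apply filter_In. rewrite E. simpl; auto.
  - exists x. apply within_spec in Wx. repeat split; auto.
    intros y Hy Hd. apply within_spec in Hd. specialize (Hm y Hy Hd). lra.
Qed.

(** The least radius exists because only the finitely many distances within [l] compete: by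
    [farthest_within] any ball shrinks to such a radius without losing points. *)
Lemma densest_ball k :
  (1 <= k <= length l)%nat ->
  exists o r, In o l /\ (k <= ball_count o r)%nat /\
    forall z rho, In z l -> rho < r -> (ball_count z rho < k)%nat.
Proof.
  intro Hk.
  destruct (minimiser (fun a => dist (fst a) (snd a))
    (fun a => (k <=? ball_count (fst a) (dist (fst a) (snd a)))%nat) (list_prod l l))
    as ((o, x) & Hin & Hc & Hmin).
  - assert (Ho : exists o, In o l) by (destruct l as [|o ?]; [simpl in Hk; lia | exists o; simpl; auto]).
    destruct Ho as (o & Ho).
    destruct (minimiser (fun x => - dist o x) (fun _ => true) l) as (x & Hx & _ & Hm); eauto.
    exists (o, x). split; [apply in_prod; auto |].
    simpl. apply Nat.leb_le. replace (ball_count o (dist o x)) with (length l); [lia |].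
    unfold ball_count. f_equal. symmetry. apply forallb_filter_id, forallb_forall.
    intros y Hy. apply within_spec. specialize (Hm y Hy eq_refl). lra.
  - simpl in *. apply Nat.leb_le in Hc. apply in_prod_iff in Hin.
    exists o, (dist o x). repeat split; try tauto.
    intros z rho Hz Hr. apply Nat.lt_nge. intro Hge.
    destruct (farthest_within z rho) as (y & Hy & Hyd & Hmax); [lia |].
    assert (Hzy : (k <= ball_count z (dist z y))%nat).
    { eapply Nat.le_trans; [exact Hge |]. apply filter_length_impl.
      intros t Ht Wt. apply within_spec in Wt. apply within_spec; auto. }
    specialize (Hmin (z, y)). simpl in Hmin.
    assert (dist o x <= dist z y); [| lra].
    apply Hmin; [apply in_prod; auto | apply Nat.leb_le, Hzy].
Qed.

(* Balls that are small compared with the densest one have few points, and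
   [L ^ 4] of them cover a ball of four times its radius. *)
Lemma light_neighbourhood k r p :
  In p l ->
  (forall z rho, In z l -> rho < r -> (ball_count z rho < k)%nat) ->
  0 < r -> (ball_count p (4 * r) <= L ^ 4 * k)%nat.
Proof.
  intros Hp Hlight Hr.
  destruct (iterated_cover 4 p (4 * r) (l_lt p Hp)) as (cs & C1 & C2 & C3); [lra |].
  apply Nat.le_trans with (length cs * k)%nat; [| apply Nat.mul_le_mono_r, C1].
  apply (cover_count (fun q x => within q (4 * r / 2 ^ 4) x)).
  - intros x Hx. apply filter_In in Hx. destruct Hx as [Hx Wx]. apply within_spec in Wx.
    destruct (C3 x (l_lt x Hx) Wx) as (q & Hq & Hd). exists q. split; auto. apply within_spec, Hd.
  - intros q Hq. eapply Nat.le_trans; [apply filter_filter_length |].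
    destruct (filter (within q (4 * r / 2 ^ 4)) l) as [|s k'] eqn:E; [simpl; lia |].
    rewrite <- E.
    assert (Hs : In s (filter (within q (4 * r / 2 ^ 4)) l)) by (rewrite E; simpl; auto).
    apply filter_In in Hs. destruct Hs as [Hs Ws]. apply within_spec in Ws.
    assert (Hsl : (ball_count s (r / 2) < k)%nat) by (apply Hlight; auto; lra).
    apply Nat.lt_le_incl. eapply Nat.le_lt_trans; [| exact Hsl].
    apply filter_length_impl. intros x Hx Wx. apply within_spec in Wx. apply within_spec.
    pose proof (dist_tri s q x (l_lt s Hs) (C2 q Hq) (l_lt x Hx)) as Ht.
    rewrite (dist_sym s q) in Ht by auto. simpl in *. lra.
Qed.

(** The ball around [p] through the farthest point of small rank contains all points of small rank,
    yet has fewer than m points. *)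
Lemma most_have_large_rank p rho m :
  (1 <= m)%nat -> (2 * m <= ball_count p rho)%nat ->
  (m <= length (filter (fun q => within p rho q && (m <=? ball_count p (dist p q))%nat) l))%nat.
Proof.
  intros Hm Hc.
  set (bad := filter (fun q => within p rho q && negb (m <=? ball_count p (dist p q))%nat) l).
  assert (Hs : (length (filter (fun q => within p rho q && (m <=? ball_count p (dist p q))%nat) l)
    + length bad = ball_count p rho)%nat).
  { apply filter_andb_negb_length. }
  enough (length bad < m)%nat by lia.
  destruct bad as [|b bad'] eqn:E; [simpl; lia |]. rewrite <- E.
  destruct (minimiser (fun x => - dist p x) (fun _ => true) bad) as (q & Hq & _ & Hmax).
  { exists b. rewrite E. simpl; auto. }
  assert (Hq' := Hq). unfold bad in Hq'. apply filter_In in Hq'.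
  destruct Hq' as [_ Hq']. apply andb_prop in Hq'. destruct Hq' as [_ Hq'].
  apply Bool.negb_true_iff, Nat.leb_gt in Hq'.
  eapply Nat.le_lt_trans; [| exact Hq'].
  apply NoDup_incl_length; [apply NoDup_filter, l_nodup |].
  intros x Hx. apply filter_In. specialize (Hmax x Hx eq_refl).
  unfold bad in Hx. apply filter_In in Hx. split; [tauto |]. apply within_spec. lra.
Qed.

(** * Random annuli and the success of a trial *)

Definition annulus_inner (p q k T : nat) : R := INR k * (dist p q / INR T) + dist p q.

(** The summands are ordered as in the program, which adds the width to the inner radius to get the
    outer one. *)
Lemma annulus_inner_S p q k T :
  annulus_inner p q (S k) T = dist p q / INR T + annulus_inner p q k T.
Proof. unfold annulus_inner. rewrite S_INR. ring. Qed.

(** The first two tests shrink both parts by a constant factor; the third limits the points that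
    land in both. *)
Definition accepts (m T p q k : nat) : bool :=
  ((2 * ball_count p (annulus_inner p q (S k) T) <=? length l) &&
   (m <=? ball_count p (annulus_inner p q k T)) &&
   ((ball_count p (annulus_inner p q (S k) T) - ball_count p (annulus_inner p q k T)) * T
      <=? 2 * length l))%nat.

(** All randomness of a trial is one number below T B B, read in mixed radix: the annulus, then the
    index of q, then the index of p. *)
Definition trial_accepts (m B T z : nat) : bool :=
  let k := (z mod T)%nat in
  let v := (z / T mod B)%nat in
  let u := (z / T / B)%nat in
  ((u <? length l) && (v <? length l) && accepts m T (nth u l O) (nth v l O) k)%nat.

Lemma annulus_inner_bounds p q k T :
  0 <= dist p q -> (k <= T)%nat -> (1 <= T)%nat ->
  dist p q <= annulus_inner p q k T <= 2 * dist p q.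
Proof.
  intros Hpq Hk HT. unfold annulus_inner.
  assert (HT' : 0 < INR T) by (apply lt_0_INR; lia).
  assert (Hw : 0 <= dist p q / INR T)
    by (apply Rmult_le_pos; [auto | apply Rlt_le, Rinv_0_lt_compat; auto]).
  assert (0 <= INR k * (dist p q / INR T)) by (apply Rmult_le_pos; auto; apply pos_INR).
  assert (H1 : INR k * (dist p q / INR T) <= INR T * (dist p q / INR T))
    by (apply Rmult_le_compat_r; auto; apply le_INR; lia).
  replace (INR T * (dist p q / INR T)) with (dist p q) in H1 by (field; lra). lra.
Qed.

(** All radii lie between [dist p q] and 4 r, so the first two tests always pass. The third passes
    for half of the annuli by Markov's inequality for the ball counts. *)
Lemma accepted_annuli m T p q r :
  (1 <= T)%nat -> In p l -> In q l ->
  (2 * ball_count p (4 * r) <= length l)%nat ->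
  dist p q <= 2 * r -> (m <= ball_count p (dist p q))%nat ->
  (T <= 2 * nsum (fun k => if accepts m T p q k then 1 else 0) T)%nat.
Proof.
  intros HT Hp Hq Hc Hr Hm.
  assert (Hpq : 0 <= dist p q) by (apply dist_nonneg; auto).
  assert (HT' : 0 < INR T) by (apply lt_0_INR; lia).
  assert (Hw : 0 <= dist p q / INR T)
    by (apply Rmult_le_pos; [auto | apply Rlt_le, Rinv_0_lt_compat; auto]).
  eapply Nat.le_trans.
  - apply (few_large_increments (fun k => ball_count p (annulus_inner p q k T)) (length l) T).
    + destruct l; [destruct Hp | simpl; lia].
    + intro k. apply ball_count_mono. rewrite annulus_inner_S. lra.
    + apply ball_count_le.
  - apply Nat.mul_le_mono_l, nsum_le. intros k Hk.
    unfold accepts. destruct (_ * T <=? _)%nat; [| lia].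
    assert (H1 : annulus_inner p q (S k) T <= 4 * r)
      by (destruct (annulus_inner_bounds p q (S k) T); auto; lra).
    assert (H2 : dist p q <= annulus_inner p q k T)
      by (apply annulus_inner_bounds; auto; lia).
    apply (ball_count_mono p) in H1, H2.
    replace (2 * _ <=? length l)%nat with true by (symmetry; apply Nat.leb_le; lia).
    replace (m <=? _)%nat with true by (symmetry; apply Nat.leb_le; lia).
    simpl. lia.
Qed.

Lemma ball_count_nonpos p rho : In p l -> rho <= 0 -> (ball_count p rho <= 1)%nat.
Proof.
  intros Hp Hr. unfold ball_count.
  apply (NoDup_incl_length (NoDup_filter _ l_nodup) (l' := p :: nil)).
  intros x Hx. apply filter_In in Hx. destruct Hx as [Hx Wx]. apply within_spec in Wx.
  destruct (Nat.eq_dec p x) as [->|E]; [simpl; auto |].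
  pose proof (dist_pos p x (l_lt p Hp) (l_lt x Hx) E). lra.
Qed.

(** At least 2 m choices of p, for each of them m choices of q, and for each pair T / 2 annuli. *)
Lemma many_trials_accepted m B T :
  (1 <= m)%nat -> (4 * L ^ 4 * m <= length l)%nat -> (1 <= L)%nat ->
  (length l <= B)%nat -> (1 <= T)%nat ->
  (m * m * T <= nsum (fun z => if trial_accepts m B T z then 1 else 0) (T * B * B))%nat.
Proof.
  intros Hm Hn HL HB HT.
  assert (HL4 : (1 <= L ^ 4)%nat) by (apply Nat.neq_0_lt_0, Nat.pow_nonzero; lia).
  destruct (densest_ball (2 * m)) as (o & r & Ho & Hdense & Hlight); [nia |].
  assert (Hr : 0 < r).
  { apply Rnot_le_lt. intro Hr.
    pose proof (ball_count_nonpos o r Ho Hr). lia. }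
  (* The ball of radius 2 r around any point p of the densest ball contains that ball. *)
  assert (Hgood : forall p, In p l -> within o r p = true ->
    (2 * m <= ball_count p (2 * r))%nat).
  { intros p Hp Wp. apply within_spec in Wp. eapply Nat.le_trans; [exact Hdense |].
    apply filter_length_impl. intros x Hx Wx. apply within_spec in Wx. apply within_spec.
    pose proof (dist_tri p o x (l_lt p Hp) (l_lt o Ho) (l_lt x Hx)) as Ht.
    rewrite (dist_sym p o) in Ht by auto. lra. }
  assert (Hgoal : (m * T * ball_count o r <= 2 * nsum (fun u => nsum (fun v => nsum (fun k =>
      if trial_accepts m B T (k + T * (v + B * u)) then 1 else 0) T) B) B)%nat).
  { rewrite <- nsum_mul_l. apply nsum_ge_filter; auto.
    intros u Hu Wu. set (p := nth u l 0%nat) in *.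
    assert (Hp : In p l) by (apply nth_In, Hu).
    specialize (Hgood p Hp Wu).
    rewrite <- nsum_mul_l.
    apply Nat.le_trans with (T * length (filter (fun q => within p (2 * r) q &&
      (m <=? ball_count p (dist p q))%nat) l))%nat.
    { rewrite (Nat.mul_comm m). apply Nat.mul_le_mono_l, most_have_large_rank; auto. }
    apply nsum_ge_filter; auto.
    intros v Hv Wv. set (q := nth v l 0%nat) in *.
    assert (Hq : In q l) by (apply nth_In, Hv).
    apply andb_prop in Wv. destruct Wv as [Wq Wm].
    apply within_spec in Wq. apply Nat.leb_le in Wm.
    rewrite (nsum_ext _ (fun k => if accepts m T p q k then 1 else 0)%nat).
    - apply (accepted_annuli m T p q r); auto.
      (* Twice this bound must not exceed the length of [l]: this is the source of the factor 4 L ^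
         4. *)
      assert (ball_count p (4 * r) <= L ^ 4 * (2 * m))%nat by (apply light_neighbourhood; auto).
      nia.
    - intros k Hk. unfold trial_accepts.
      destruct (div_mod_digits T k (v + B * u)) as [-> ->]; auto.
      destruct (div_mod_digits B v u) as [-> ->]; [lia |].
      apply Nat.ltb_lt in Hu, Hv. rewrite Hu, Hv. reflexivity. }
  rewrite nsum_prod.
  rewrite (nsum_ext _ (fun u => nsum (fun v => nsum (fun k =>
      if trial_accepts m B T (k + T * (v + B * u)) then 1 else 0) T) B))%nat; [nia |].
  intros u _. rewrite nsum_prod.
  apply nsum_ext; intros v _. apply nsum_ext; intros k _.
  replace (k + T * v + T * B * u)%nat with (k + T * (v + B * u))%nat by ring. reflexivity.
Qed.

(* The inner ball is too crowded for its points to be more than the width of an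
   annulus apart, whereas the pairs that are separated are further apart. *)
Lemma closest_pair_not_split m s p q k x y :
  (1 <= L)%nat -> (L ^ (s + 2) < m)%nat -> (k < 2 ^ s)%nat ->
  In p l -> In q l ->
  (m <= ball_count p (annulus_inner p q k (2 ^ s)))%nat ->
  In x l -> In y l -> x <> y ->
  (forall a b, (a < N)%nat -> (b < N)%nat -> a <> b -> dist x y <= dist a b) ->
  (within p (annulus_inner p q (S k) (2 ^ s)) x = true /\
   within p (annulus_inner p q (S k) (2 ^ s)) y = true) \/
  (within p (annulus_inner p q k (2 ^ s)) x = false /\
   within p (annulus_inner p q k (2 ^ s)) y = false).
Proof.
  intros HL Hm Hk Hp Hq Hc Hx Hy Hxy Hmin.
  assert (HT : (1 <= 2 ^ s)%nat) by (apply Nat.neq_0_lt_0, Nat.pow_nonzero; lia).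
  assert (HLs : (1 <= L ^ (s + 2))%nat) by (apply Nat.neq_0_lt_0, Nat.pow_nonzero; lia).
  assert (Hpq : 0 <= dist p q) by (apply dist_nonneg; auto).
  destruct (annulus_inner_bounds p q k (2 ^ s)) as [_ Hr]; auto; [lia |].
  set (w := dist p q / INR (2 ^ s)).
  assert (HTR : 0 < 2 ^ s) by (apply pow_lt; lra).
  assert (HTI : INR (2 ^ s) = 2 ^ s) by (rewrite pow_INR; reflexivity).
  assert (Hw : 0 <= w) by (apply Rmult_le_pos; [auto | rewrite HTI; apply Rlt_le, Rinv_0_lt_compat; auto]).
  assert (Hclose : dist x y <= w).
  { apply Rnot_lt_le. intro Hlt.
    destruct (Req_dec (dist p q) 0) as [H0|H0].
    - pose proof (ball_count_nonpos p (annulus_inner p q k (2 ^ s)) Hp ltac:(lra)). lia.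
    - assert (length (filter (within p (annulus_inner p q k (2 ^ s))) l) <= L ^ (s + 2))%nat;
        [| unfold ball_count in Hc; lia].
      (* The inner ball has radius at most 2 R and w = R / 2 ^ s, so 2 (2 R) = w 2 ^ (s + 2); hence
         the exponent s + 2. *)
      apply (packing p (2 * dist p q) w); auto; try lra.
      + apply NoDup_filter, l_nodup.
      + intros a Ha. apply filter_In in Ha. apply l_lt, Ha.
      + intros a Ha. apply filter_In in Ha. destruct Ha as [_ Ha]. apply within_spec in Ha. lra.
      + intros a b Ha Hb Hab. apply filter_In in Ha, Hb.
        eapply Rlt_le_trans; [exact Hlt |]. apply Hmin; auto; apply l_lt; tauto.
      + unfold w. rewrite HTI, pow_add. right. field. lra. }
  rewrite !within_spec, !within_false, !annulus_inner_S. fold w.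
  set (r1 := annulus_inner p q k (2 ^ s)) in *.
  pose proof (dist_tri p x y (l_lt p Hp) (l_lt x Hx) (l_lt y Hy)).
  pose proof (dist_tri p y x (l_lt p Hp) (l_lt y Hy) (l_lt x Hx)) as Ht.
  rewrite (dist_sym y x) in Ht by auto.
  (* If one of the points is outside the outer sphere, the other is at most w closer to p, hence
     still outside the inner one. *)
  destruct (Rle_lt_dec (dist p x) (w + r1)); destruct (Rle_lt_dec (dist p y) (w + r1));
    auto; right; split; lra.
Qed.

End Doubling.

(** * The potential *)

Lemma ln_monotone x y : 0 < x -> x <= y -> ln x <= ln y.
Proof.
  intros Hx [H | ->]; [| lra]. apply Rlt_le, ln_increasing; auto.
Qed.

Lemma ln_le_pred x : 0 < x -> ln x <= x - 1.
Proof.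
  intro H. rewrite <- (ln_exp (x - 1)). apply ln_monotone; auto.
  pose proof (exp_ineq1_le (x - 1)). lra.
Qed.

(** The summand 1 keeps the potential at least n even for n = 1, so it covers linear work on every
    item. *)
Definition phi (n : nat) : R := INR n * (1 + ln (INR n)).

Lemma phi_ge n : (1 <= n)%nat -> INR n <= phi n.
Proof.
  intro H. unfold phi. apply le_INR in H. simpl in H.
  assert (0 <= ln (INR n)) by (rewrite <- ln_1; apply ln_monotone; lra). nra.
Qed.

Lemma phi_shrink n i beta :
  0 < beta -> (1 <= i)%nat -> (1 <= n)%nat -> INR i <= (1 - beta) * INR n ->
  phi i <= INR i * (1 + ln (INR n) - beta).
Proof.
  intros Hb Hi Hn H. apply le_INR in Hi, Hn. simpl in Hi, Hn.
  assert (Hl : ln (INR i) <= ln (INR n) - beta).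
  { replace (INR i) with (INR i / INR n * INR n) by (field; lra).
    assert (0 < INR i / INR n) by (apply Rdiv_lt_0_compat; lra).
    rewrite ln_mult by lra.
    pose proof (ln_le_pred (INR i / INR n) H0).
    assert (INR i / INR n <= 1 - beta); [| lra].
    apply Rmult_le_reg_r with (INR n); [lra |].
    unfold Rdiv. rewrite Rmult_assoc, Rinv_l by lra. lra. }
  unfold phi. apply Rmult_le_compat_l; lra.
Qed.

(** With beta = 1 / (8 L ^ 4), both parts have size at most (1 - beta) n, so each point loses beta
    in its logarithm. The at most 2 n / T duplicates cost no more than half of this total gain,
    since T is at least 64 L ^ 4 b and 1 + ln n at most 2 b. *)
Lemma split_potential L n b T n1 n2 :
  (1 <= L)%nat -> (1 <= n / (4 * L ^ 4))%nat -> (n <= 2 ^ b)%nat -> (1 <= b)%nat ->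
  (64 * L ^ 4 * b <= T)%nat -> (1 <= n1)%nat -> (1 <= n2)%nat ->
  (2 * n1 <= n)%nat -> (n2 + n / (4 * L ^ 4) <= n)%nat -> ((n1 + n2 - n) * T <= 2 * n)%nat ->
  phi n1 + phi n2 <= phi n - INR n / (16 * INR L ^ 4).
Proof.
  intros HL Hm Hnb Hb HT H1 H2 Hn1 Hn2 Hov.
  assert (HL4 : (1 <= L ^ 4)%nat) by (apply Nat.neq_0_lt_0, Nat.pow_nonzero; lia).
  (* A quotient of at least 1 loses less than a factor 2 by rounding down. *)
  assert (Hmn : (n <= 8 * L ^ 4 * (n / (4 * L ^ 4)))%nat).
  { pose proof (Nat.mul_succ_div_gt n (4 * L ^ 4)). nia. }
  rewrite <- pow_INR. set (A := (L ^ 4)%nat) in *. set (m := (n / (4 * A))%nat) in *.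
  assert (HT0 : (1 <= T)%nat) by nia.
  assert (Hn : (2 <= n)%nat) by lia.
  apply le_INR in HL4, Hmn, Hn1, Hn2, Hov, HT, HT0, Hb.
  assert (HnR := le_INR _ _ Hn).
  assert (HnbR := le_INR _ _ Hnb).
  rewrite ?mult_INR, ?plus_INR, ?pow_INR in *.
  assert (Hov' : (INR n1 + INR n2 - INR n) * INR T <= 2 * INR n).
  { destruct (Nat.le_gt_cases n (n1 + n2)) as [Hc|Hc].
    - rewrite minus_INR, plus_INR in Hov by auto. simpl (INR 2) in Hov. lra.
    - apply lt_INR in Hc. rewrite plus_INR in Hc.
      pose proof (pos_INR T) as HTp. pose proof (pos_INR n) as Hnp.
      clear - Hc HTp Hnp. nra. }
  clear Hov.
  rewrite !INR_IZR_INZ with (n := 64%nat), !INR_IZR_INZ with (n := 8%nat),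
    !INR_IZR_INZ with (n := 2%nat) in *.
  cbn [Z.of_nat Pos.of_succ_nat Pos.succ] in *. change (INR 1) with 1 in *.
  set (beta := / (8 * INR A)).
  assert (Hbeta : 0 < beta) by (apply Rinv_0_lt_compat; lra).
  assert (HbA : 8 * INR A * beta = 1) by (apply Rinv_r; lra).
  assert (Hbm : beta * INR n <= INR m).
  { apply Rmult_le_reg_l with (8 * INR A); [lra |].
    rewrite <- Rmult_assoc, HbA. lra. }
  assert (Hbh : beta <= / 8) by (apply Rinv_le_contravar; lra).
  pose proof (phi_shrink n n1 beta Hbeta H1 ltac:(lia)) as P1.
  pose proof (phi_shrink n n2 beta Hbeta H2 ltac:(lia)) as P2.
  assert (P1' : phi n1 <= INR n1 * (1 + ln (INR n) - beta)) by (apply P1; nra).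
  assert (P2' : phi n2 <= INR n2 * (1 + ln (INR n) - beta)) by (apply P2; nra).
  assert (Hln0 : 0 <= ln (INR n)) by (rewrite <- ln_1; apply ln_monotone; lra).
  assert (Hln : 1 + ln (INR n) <= 2 * INR b).
  { assert (ln (INR n) <= INR b * ln 2) by (rewrite <- ln_pow by lra; apply ln_monotone; lra).
    pose proof (ln_le_pred 2 ltac:(lra)). nra. }
  set (x := 1 + ln (INR n)) in *.
  set (o := INR n1 + INR n2 - INR n) in *.
  assert (Ho : o * (x - beta) <= INR n * beta / 2).
  { destruct (Rle_lt_dec o 0) as [Ho|Ho].
    - assert (0 <= INR n * beta) by nra. assert (0 <= x - beta) by (unfold x; lra). nra.
    - assert (E : o * x * (16 * INR A) <= INR n).
      { assert (o * (64 * INR A * INR b) <= 2 * INR n) by nra.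
        assert (o * x <= o * (2 * INR b)) by (apply Rmult_le_compat_l; lra). nra. }
      assert (o * x <= INR n * beta / 2).
      { apply Rmult_le_reg_r with (16 * INR A); [lra |].
        replace (INR n * beta / 2 * (16 * INR A)) with (INR n * (8 * INR A * beta)) by field.
        rewrite HbA. lra. }
      nra. }
  replace (INR n / (16 * INR A)) with (INR n * beta / 2) by (unfold beta; field; lra).
  change (phi n) with (INR n * x). unfold o in Ho. nra.
Qed.

(** With q = b / E, the power (b + 1) ^ D is at most E ^ D 2 ^ (q D), and q D is at most b / 2. What
    is left of 2 ^ b is then bounded by the constant C E ^ D. *)
Lemma exponential_beats_polynomial C D :
  exists b0, forall b, (2 ^ b <= C * (b + 1) ^ D)%nat -> (b <= b0)%nat.
Proof.
  set (E := (2 * (D + 1))%nat). exists (2 * (C * E ^ D))%nat. intros b H.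
  set (q := (b / E)%nat).
  assert (Hq : (b + 1 <= E * 2 ^ q)%nat).
  { pose proof (Nat.mul_succ_div_gt b E ltac:(lia)). fold q in H0.
    pose proof (Nat.pow_gt_lin_r 2 q ltac:(lia)). nia. }
  assert (Hp : ((b + 1) ^ D <= E ^ D * 2 ^ (q * D))%nat).
  { rewrite Nat.pow_mul_r, <- Nat.pow_mul_l. apply Nat.pow_le_mono_l, Hq. }
  assert (Hqb : (E * q <= b)%nat) by apply Nat.Div0.mul_div_le.
  assert (Hqd : (2 * (q * D) <= b)%nat) by (unfold E in Hqb; nia).
  assert (Hs : (2 ^ (q * D) * 2 ^ (q * D) <= 2 ^ b)%nat).
  { rewrite <- Nat.pow_add_r. apply Nat.pow_le_mono_r; lia. }
  assert (Hs2 : (2 ^ b <= C * E ^ D * 2 ^ (q * D))%nat) by nia.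
  assert (Hs3 : (2 ^ b = 2 ^ (q * D) * 2 ^ (b - q * D))%nat).
  { rewrite <- Nat.pow_add_r. f_equal. lia. }
  assert (0 < 2 ^ (q * D))%nat by (apply Nat.neq_0_lt_0, Nat.pow_nonzero; lia).
  assert (Hs4 : (2 ^ (b - q * D) <= C * E ^ D)%nat) by nia.
  pose proof (Nat.pow_gt_lin_r 2 (b - q * D) ltac:(lia)). lia.
Qed.

(** As L = 2 ^ D, the power L ^ s equals (2 ^ s) ^ D, a polynomial in b, whereas n is at least 2 ^ b
    / 2. *)
Lemma brute_force_bound D :
  exists n0, forall n b s,
    (2 ^ b <= 2 * n)%nat -> (n <= 2 ^ b)%nat ->
    (2 ^ s <= 128 * (2 ^ D) ^ 4 * b + 1)%nat ->
    (n / (4 * (2 ^ D) ^ 4) <= (2 ^ D) ^ (s + 2))%nat -> (n <= n0)%nat.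
Proof.
  set (L := (2 ^ D)%nat).
  assert (HL : (1 <= L)%nat) by (apply Nat.neq_0_lt_0, Nat.pow_nonzero; lia).
  assert (HL4 : (1 <= L ^ 4)%nat) by (apply Nat.neq_0_lt_0, Nat.pow_nonzero; lia).
  destruct (exponential_beats_polynomial (16 * L ^ 6 * (128 * L ^ 4) ^ D) D) as (b0 & Hb0).
  exists (2 ^ b0)%nat. intros n b s Hb Hn Hs Hm.
  eapply Nat.le_trans; [exact Hn |]. apply Nat.pow_le_mono_r; [lia |]. apply Hb0.
  assert (HLs : (L ^ (s + 2) = L ^ 2 * (2 ^ s) ^ D)%nat).
  { rewrite Nat.pow_add_r, Nat.mul_comm. f_equal. unfold L.
    rewrite <- !Nat.pow_mul_r. f_equal. lia. }
  assert (Hp : ((2 ^ s) ^ D <= (128 * L ^ 4) ^ D * (b + 1) ^ D)%nat).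
  { rewrite <- Nat.pow_mul_l. apply Nat.pow_le_mono_l. nia. }
  pose proof (Nat.mul_succ_div_gt n (4 * L ^ 4) ltac:(lia)) as Hd.
  assert (HLs1 : (1 <= L ^ (s + 2))%nat) by (apply Nat.neq_0_lt_0, Nat.pow_nonzero; lia).
  assert (Hn1 : (n <= 4 * L ^ 4 * (2 * L ^ (s + 2)))%nat) by nia.
  replace (L ^ 6)%nat with (L ^ 4 * L ^ 2)%nat by (rewrite <- Nat.pow_add_r; reflexivity).
  rewrite HLs in Hn1. set (P := ((128 * L ^ 4) ^ D * (b + 1) ^ D)%nat) in *.
  assert (L ^ 4 * L ^ 2 * (2 ^ s) ^ D <= L ^ 4 * L ^ 2 * P)%nat by (apply Nat.mul_le_mono_l, Hp).
  rewrite <- Nat.mul_assoc. fold P. lia.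
Qed.

(** * The program *)

(* A jump names the absolute position of its target; the comments give the
   position of the first instruction of each block.  Natural registers:
     0 N, 1 one, 2 two, 3 L, 4 D, 5 M = N + 32 (distance between items),
     6 and 7 head and tail of the queue, 8 n, 9 and 10 loop counters,
     11, 12, 13 addresses and points, 14 B, 15 b, 16 T, 17 L ^ (s + 2), 18 m,
     19 Z, 20 and 21 powers of two, 22 p, 23 q, 24 k, 25 and 26 ends of the new
     items, 27 and 28 multiples of L ^ 4, 29 address of the second new item,
     30 and 31 scratch.
   An item at address a is stored as its size in cell a and its points in the
   cells a + 1, a + 2, ....  Real registers: 0 first d, then the smallest
   distance found; 1, 2, 3 radii; 4 scratch. *)
Definition closest_pair : list instr :=
 [
   (* 0: constants *)
   NConst 1 1; NConst 2 2; NConst 3 1; NConst 4 0;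
   (* 4: least D with d <= D, and L := 2 ^ D *)
   RofN 1 4; JRLt 1 0 7; Jmp 10; NAdd 4 4 1; NMul 3 3 2; Jmp 4;
   (* 10 *)
   NMul 27 3 3; NMul 27 27 27; NConst 28 4; NMul 27 27 28; NConst 28 16; NMul 28 28 27;
   NConst 5 32; NAdd 5 5 0; NMul 6 5 1; NAdd 7 5 5; NStore 5 0; NConst 9 0; NAdd 11 5 1;
   (* 23: first item: all points *)
   JNLt 9 0 25; Jmp 29; NStore 11 9; NAdd 11 11 1; NAdd 9 9 1; Jmp 23;
   (* 29 *)
   NConst 12 0; RQuery 0 12 1;
   (* 31: next item, of size n *)
   JNLt 6 7 33; Halt; NLoad 8 6; NConst 14 1; NConst 15 0;
   (* 36: B := 2 ^ b with n <= B <= 2 n *)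
   JNLt 14 8 38; Jmp 41; NMul 14 14 2; NAdd 15 15 1; Jmp 36;
   (* 41 *)
   NConst 16 1; NMul 17 3 3; NMul 30 28 15;
   (* 44: T := 2 ^ s >= 64 L ^ 4 b and L ^ (s + 2) *)
   JNLt 16 30 46; Jmp 49; NMul 16 16 2; NMul 17 17 3; Jmp 44;
   (* 49: m := n / (4 L ^ 4) *)
   NDiv 18 8 27; JNLt 17 18 68;
   (* 51: few points: compare all pairs *)
   NConst 9 0; JNLt 9 8 54; Jmp 132; NAdd 9 9 1; NAdd 11 6 9; NLoad 12 11; NConst 10 1;
   JNLt 10 9 60; Jmp 52; NAdd 11 6 10; NLoad 13 11; RQuery 4 12 13; NAdd 10 10 1;
   JRLt 4 0 66; Jmp 58; RQuery 0 12 13; Jmp 58;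
   (* 68: trial: Z uniform below T B B *)
   NConst 19 0; NConst 20 1; NMul 21 16 14; NMul 21 21 14; JNLt 20 21 74; Jmp 79;
   NRand 30; NMul 30 30 20; NAdd 19 19 30; NMul 20 20 2; Jmp 72;
   (* 79: k, p, q from the digits of Z *)
   NMod 24 19 16; NDiv 19 19 16; NMod 23 19 14; NDiv 22 19 14; JNLt 22 8 85; Jmp 68;
   JNLt 23 8 87; Jmp 68; NAdd 22 22 6; NAdd 22 22 1; NLoad 22 22; NAdd 23 23 6;
   NAdd 23 23 1; NLoad 23 23;
   (* 93: R := dist p q, r1 := R + k R / T, r2 := r1 + R / T *)
   RQuery 1 22 23; RofN 2 16; RDiv 3 1 2; RofN 2 24; RMul 2 2 3; RAdd 2 2 1; RAdd 3 3 2;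
   NAdd 29 7 5; NMul 25 7 1; NMul 26 29 1; NConst 9 0;
   (* 104: split at the annulus into the next two items *)
   JNLt 9 8 106; Jmp 118; NAdd 9 9 1; NAdd 11 6 9; NLoad 12 11; RQuery 4 22 12;
   JRLt 3 4 113; NAdd 25 25 1; NStore 25 12; JRLt 2 4 115; Jmp 104; NAdd 26 26 1;
   NStore 26 12; Jmp 104;
   (* 118: acceptance test *)
   NSub 25 25 7; NSub 26 26 29; NMul 30 25 2; JNLt 8 30 68; NAdd 30 26 18; JNLt 8 30 68;
   NAdd 30 25 26; NSub 30 30 8; NMul 30 30 16; NMul 31 8 2; JNLt 31 30 68;
   (* 129: enqueue both items *)
   NStore 7 25; NStore 29 26; NAdd 7 29 5;
   (* 132: dequeue *)
   NAdd 6 6 5; Jmp 31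
 ].

(** * Memory frames and arrays *)

Arguments updn _ _ _ _ /.
Arguments updr _ _ _ _ /.

(** Frame condition of a block of code: [S] lists the cells it may overwrite. *)
Definition agree_off (S : list nat) (n n' : nat -> nat) : Prop :=
  forall a, ~ In a S -> n' a = n a.

Lemma agree_off_updn S n a x n' :
  In a S -> agree_off S (updn n a x) n' -> agree_off S n n'.
Proof.
  intros Ha H b Hb. rewrite H by auto. cbn [updn].
  destruct (Nat.eqb_spec b a); [subst; contradiction | reflexivity].
Qed.

Lemma agree_off_incl S S' n n' : incl S S' -> agree_off S n n' -> agree_off S' n n'.
Proof. intros Hi H a Ha. apply H. intro Hs. apply Ha, Hi, Hs. Qed.

Lemma agree_off_trans S n n' n'' : agree_off S n n' -> agree_off S n' n'' -> agree_off S n n''.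
Proof. intros H H' a Ha. rewrite H', H by exact Ha. reflexivity. Qed.

Lemma agree_off_refl S n : agree_off S n n.
Proof. intros a _. reflexivity. Qed.

(** Frame condition for code that also writes new items into the free memory from [e] on. *)
Definition agree_below (e : nat) (S : list nat) (n n' : nat -> nat) : Prop :=
  forall a, (a < e)%nat -> ~ In a S -> n' a = n a.

Lemma agree_below_updn e S n a x n' :
  (In a S \/ e <= a)%nat -> agree_below e S (updn n a x) n' -> agree_below e S n n'.
Proof.
  intros Ha H b Hb Hn. rewrite H by auto. cbn [updn].
  destruct (Nat.eqb_spec b a); [subst; destruct Ha; [contradiction | lia] | reflexivity].
Qed.

Lemma agree_below_incl e S S' n n' :
  incl S S' -> agree_below e S n n' -> agree_below e S' n n'.
Proof. intros Hi H a Ha Hs. apply H; auto. Qed.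

Lemma agree_below_trans e S n n' n'' :
  agree_below e S n n' -> agree_below e S n' n'' -> agree_below e S n n''.
Proof. intros H H' a Ha Hs. rewrite H', H by auto. reflexivity. Qed.

Lemma agree_off_below e S n n' : agree_off S n n' -> agree_below e S n n'.
Proof. intros H a _ Ha. auto. Qed.

Definition array (n : nat -> nat) (a : nat) (l : list nat) : Prop :=
  forall i, (i < length l)%nat -> n (a + S i)%nat = nth i l O.

Lemma array_agree_off S n n' h l :
  Forall (fun a => (a <= h)%nat) S -> agree_off S n n' -> array n h l -> array n' h l.
Proof.
  intros HS H Hl i Hi. rewrite H; auto. intro Hin.
  rewrite Forall_forall in HS. apply HS in Hin. lia.
Qed.

Lemma array_agree_below e S n n' h l :
  Forall (fun a => (a <= h)%nat) S -> (h + length l < e)%nat ->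
  agree_below e S n n' -> array n h l -> array n' h l.
Proof.
  intros HS He H Hl i Hi. rewrite H; auto; [lia |]. intro Hin.
  rewrite Forall_forall in HS. apply HS in Hin. lia.
Qed.

Lemma array_updn_off n c x a l :
  (c <= a \/ a + length l < c)%nat -> array n a l -> array (updn n c x) a l.
Proof.
  intros Hc H i Hi. cbn [updn]. destruct (Nat.eqb_spec (a + S i) c); [lia | auto].
Qed.

Lemma array_updn_snoc n a l x :
  array n a l -> array (updn n (a + S (length l)) x) a (l ++ [x]).
Proof.
  intros H i Hi. rewrite length_app in Hi. simpl in Hi. cbn [updn].
  destruct (Nat.eqb_spec (a + S i) (a + S (length l))).
  - rewrite app_nth2 by lia. replace (i - length l)%nat with O by lia. reflexivity.
  - rewrite app_nth1 by lia. apply H. lia.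
Qed.

Lemma psum_even_odd f n :
  psum f (2 * n) = psum (fun i => f (2 * i)%nat + f (2 * i + 1)%nat) n.
Proof.
  induction n as [|n IH]; auto.
  replace (2 * S n)%nat with (S (S (2 * n))) by lia.
  cbn [psum]. rewrite IH. replace (2 * n + 1)%nat with (S (2 * n)) by lia. lra.
Qed.

Definition trial_registers : list nat := [9; 11; 12; 19; 20; 21; 22; 23; 24; 25; 26; 29; 30; 31]%nat.

(** * Cost rules for the blocks of the program *)

Section Program.

Variables (N : nat) (dist : nat -> nat -> R) (L : nat).
Let orc := oracle N dist.
Let Post := is_closest_pair_distance N dist.
Let M := (32 + N)%nat.

Notation "'cost' K p n r v" := (ecost closest_pair orc Post K (mkConfig p n r) v)
  (at level 10, K, p, n, r, v at level 9).

Ltac addresses :=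
  repeat (match goal with
  | |- context [Nat.eqb ?x ?k] =>
      let b := eval cbv [Nat.eqb] in (Nat.eqb x k) in
      match b with
      | true => change (Nat.eqb x k) with true
      | false => change (Nat.eqb x k) with false
      | _ => first [ rewrite (proj2 (Nat.eqb_neq x k)) by lia
                   | rewrite (proj2 (Nat.eqb_eq x k)) by lia ]
      end
  end; cbv iota).

(** Executes one instruction at price 1. It serves all instructions but [NRand], since the result
    must not depend on the coin. *)
Ltac op :=
  apply ecost_step;
  [reflexivity |
   let b := fresh in intro b;
   match goal with
   | |- ecost ?pr ?o ?P ?K ?c ?w =>
     let c' := eval cbv [step closest_pair nth_error pc nmem rmem] in c in
     let c'' := eval cbn [updn updr] in c' in
     change (ecost pr o P K c'' w)
   end; clear b; addresses].

Ltac test :=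
  match goal with
  | |- context [if (?x <? ?y)%nat then _ else _] => destruct (Nat.ltb_spec x y)
  | |- context [if Rlt_dec ?x ?y then _ else _] => destruct (Rlt_dec x y)
  end.

Ltac reg := cbn [updn updr]; addresses; try lia.

Ltac frame := repeat (apply array_updn_off; [lia |]); auto.

Ltac append :=
  repeat (apply array_updn_off; [rewrite ?length_app; cbn [length]; lia |]);
  match goal with
  | |- array (updn _ ?c _) ?a (?l ++ _) => replace c with (a + S (length l))%nat by lia
  end; apply array_updn_snoc; frame.

Ltac reject Hspec IHK Ha :=
  match goal with
  | |- context [if ?t then _ else _] =>
    let EA := fresh in
    destruct t eqn:EA;
    [ destruct (proj1 Hspec eq_refl); lia
    | apply IHK; [| congruence | lra];
      let a := fresh in let Hlt := fresh in let Hs := fresh in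
      intros a Hlt Hs; rewrite <- Ha by auto; cbn [In trial_registers] in Hs;
      cbn [updn]; addresses; reflexivity ]
  end.

Ltac peel H := repeat (apply agree_off_updn in H; [| cbn [In trial_registers]; lia]).

Ltac peel_below H := repeat (apply agree_below_updn in H; [| cbn [In trial_registers]; lia]).

Ltac off := cbn [In trial_registers]; lia.

Lemma oracle_in x y : (x < N)%nat -> (y < N)%nat -> orc x y = dist x y.
Proof.
  intros Hx Hy. unfold orc, oracle.
  apply Nat.ltb_lt in Hx, Hy. rewrite Hx, Hy. reflexivity.
Qed.

Definition constants (n : nat -> nat) : Prop :=
  n 0%nat = N /\ n 1%nat = 1%nat /\ n 2%nat = 2%nat /\ n 3%nat = L /\ n 5%nat = M /\
  n 27%nat = (4 * L ^ 4)%nat /\ n 28%nat = (64 * L ^ 4)%nat.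

(** The loop rules are in continuation style: a cost [w] at the exit, for every memory the loop may
    leave, gives a cost at the loop head. [f] bounds the rounds still to be made. *)
Lemma log_loop K n r v w len f b :
  n 1%nat = 1%nat -> n 2%nat = 2%nat -> n 8%nat = len ->
  n 14%nat = (2 ^ b)%nat -> n 15%nat = b ->
  (2 ^ b <= 2 * len)%nat -> (2 * len <= f + b)%nat ->
  (forall n' b', agree_off [14; 15]%nat n n' -> n' 14%nat = (2 ^ b')%nat -> n' 15%nat = b' ->
     (2 ^ b' <= 2 * len)%nat -> (len <= 2 ^ b')%nat -> cost K 41 n' r w) ->
  w + 5 * INR f + 2 <= v ->
  cost K 36 n r v.
Proof.
  revert n v b; induction f as [|f IH]; intros n v b H1 H2 H8 H14 H15 Hb Hf Hk Hv.
  (* With no rounds left, 2 [len] is at most b, against b < 2 ^ b. *)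
  - pose proof (Nat.pow_gt_lin_r 2 b ltac:(lia)). lia.
  - rewrite S_INR in Hv. pose proof (pos_INR f).
    op. test.
    + op. op. op. eapply (IH _ _ (S b)); reg.
      * rewrite H14, H2. simpl. lia.
      * rewrite H14, H8 in H0. simpl. lia.
      * intros n' b' Ha. peel Ha. exact (Hk n' b' Ha).
      * lra.
    + op. eapply ecost_weaken; [apply (Hk n b); auto using agree_off_refl; lia | lra].
Qed.

(** The bound 2 t + 1 instead of 2 t admits t = 0, where T stays 1. *)
Lemma annulus_loop K n r v w t f s :
  n 2%nat = 2%nat -> n 3%nat = L -> n 30%nat = t ->
  n 16%nat = (2 ^ s)%nat -> n 17%nat = (L ^ (s + 2))%nat ->
  (2 ^ s <= 2 * t + 1)%nat -> (2 * t + 2 <= f + s)%nat ->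
  (forall n' s', agree_off [16; 17]%nat n n' -> n' 16%nat = (2 ^ s')%nat ->
     n' 17%nat = (L ^ (s' + 2))%nat ->
     (2 ^ s' <= 2 * t + 1)%nat -> (t <= 2 ^ s')%nat -> cost K 49 n' r w) ->
  w + 5 * INR f + 2 <= v ->
  cost K 44 n r v.
Proof.
  revert n v s; induction f as [|f IH]; intros n v s H2 H3 H30 H16 H17 Hs Hf Hk Hv.
  - pose proof (Nat.pow_gt_lin_r 2 s ltac:(lia)). lia.
  - rewrite S_INR in Hv. pose proof (pos_INR f).
    op. test.
    + op. op. op. eapply (IH _ _ (S s)); reg.
      * rewrite H16, H2. simpl. lia.
      * rewrite H17, H3. simpl. lia.
      * rewrite H16, H30 in H0. simpl. lia.
      * intros n' s' Ha. peel Ha. exact (Hk n' s' Ha).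
      * lra.
    + op. eapply ecost_weaken; [apply (Hk n s); auto using agree_off_refl; lia | lra].
Qed.

(** The y low bits drawn so far form z, and k bits are missing. The cost is the mean of [W] over all
    completions plus 6 instructions per bit. *)
Lemma bits_loop (W : nat -> R) K n r v k y z :
  n 2%nat = 2%nat -> n 19%nat = z -> n 20%nat = (2 ^ y)%nat -> n 21%nat = (2 ^ (y + k))%nat ->
  (forall n' i, (i < 2 ^ k)%nat -> agree_off [19; 20; 30]%nat n n' ->
     n' 19%nat = (z + 2 ^ y * i)%nat -> cost K 79 n' r (W (z + 2 ^ y * i)%nat)) ->
  psum (fun i => W (z + 2 ^ y * i)%nat) (2 ^ k) / 2 ^ k + 6 * INR k + 2 <= v ->
  cost K 72 n r v.
Proof.
  revert n v y z; induction k as [|k IH]; intros n v y z H2 H19 H20 H21 Hk Hv.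
  - op. test; [rewrite H20, H21, Nat.add_0_r in H; lia |].
    op. eapply ecost_weaken.
    + apply (Hk n O); auto using agree_off_refl. rewrite H19. lia.
    + simpl in Hv. lra.
  - rewrite S_INR in Hv.
    replace (2 ^ S k)%nat with (2 * 2 ^ k)%nat in Hv by (simpl; lia).
    rewrite psum_even_odd in Hv.
    (* The next bit is the parity of the index; the factors 2 prepare for [psum_average]. *)
    rewrite <- (psum_ext (fun i => (2 * W (z + 2 ^ S y * i)%nat +
      2 * W (z + 2 ^ y + 2 ^ S y * i)%nat) / 2)) in Hv.
    2: { intros i _.
         replace (z + 2 ^ S y * i)%nat with (z + 2 ^ y * (2 * i))%nat by (simpl; lia).
         replace (z + 2 ^ y + 2 ^ S y * i)%nat with (z + 2 ^ y * (2 * i + 1))%nat by (simpl; lia).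
         lra. }
    rewrite psum_average in Hv.
    assert (Hs : forall f n, psum (fun i => 2 * f i) n = 2 * psum f n)
      by (clear; intros f n; induction n as [|n IH]; simpl; [| rewrite IH]; lra).
    rewrite !Hs in Hv. cbn [pow] in Hv.
    set (a0 := psum _ _) in Hv. set (a1 := psum _ _) in Hv.
    assert (H2k : 0 < 2 ^ k) by (apply pow_lt; lra).
    replace ((2 * a0 + 2 * a1) / 2 / (2 * 2 ^ k)) with ((a0 / 2 ^ k + a1 / 2 ^ k) / 2) in Hv
      by (field; lra).
    op. test.
    2: { rewrite H20, H21 in H. apply Nat.pow_le_mono_r_iff in H; lia. }
    apply ecost_coin with (v1 := a1 / 2 ^ k + 6 * INR k + 6)
      (v2 := a0 / 2 ^ k + 6 * INR k + 6); [reflexivity | lra | |];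
    cbv [step closest_pair nth_error pc nmem rmem]; op; op; op; op.
    + eapply (IH _ _ (S y) (z + 2 ^ y)%nat); reg.
      * rewrite H20, H2. simpl. lia.
      * rewrite H21. f_equal. lia.
      * intros n' i Hi Ha Hz. peel Ha.
        replace (z + 2 ^ y + 2 ^ S y * i)%nat with (z + 2 ^ y * (2 * i + 1))%nat in * by (simpl; lia).
        apply Hk; auto. simpl; lia.
      * unfold a1. lra.
    + eapply (IH _ _ (S y) z); reg.
      * rewrite H20, H2. simpl. lia.
      * rewrite H21. f_equal. lia.
      * intros n' i Hi Ha Hz. peel Ha.
        replace (z + 2 ^ S y * i)%nat with (z + 2 ^ y * (2 * i))%nat in * by (simpl; lia).
        apply Hk; auto. simpl; lia.
      * unfold a0. lra.
Qed.

(** Holds for the answer register from its first query on: it can only be too large. *)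
Definition attained (delta : R) : Prop :=
  exists x y, (x < N)%nat /\ (y < N)%nat /\ x <> y /\ dist x y = delta.

Lemma inner_loop K n r v w h l x i f j :
  n 1%nat = 1%nat -> n 6%nat = h -> (32 <= h)%nat -> array n h l ->
  n 9%nat = S i -> n 10%nat = S j -> n 12%nat = x ->
  (i < length l)%nat -> x = nth i l O -> NoDup l -> (forall y, In y l -> (y < N)%nat) ->
  (i = f + j)%nat -> attained (r O) ->
  (forall n' r', agree_off [10; 11; 13]%nat n n' -> attained (r' O) -> r' O <= r O ->
     (forall k, (j <= k < i)%nat -> r' O <= dist x (nth k l O)) -> cost K 52 n' r' w) ->
  w + 8 * INR f + 2 <= v ->
  cost K 58 n r v.
Proof.
  revert n r v j; induction f as [|f IH];
    intros n r v j H1 H6 Hh Harr H9 H10 H12 Hi Hx Hnd HN Hf Hatt Hk Hv.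
  - op. test; [lia |]. op.
    apply (ecost_weaken _ _ _ _ _ w); [| simpl in Hv; lra].
    apply (Hk n r); [apply agree_off_refl | auto | lra | intros; lia].
  - rewrite S_INR in Hv. pose proof (pos_INR f).
    op. test; [| lia].
    set (y := nth j l O).
    assert (Hy : In y l) by (apply nth_In; lia).
    assert (Hxl : In x l) by (rewrite Hx; apply nth_In; lia).
    assert (Hxy : x <> y).
    { intro E. rewrite Hx in E. apply (proj1 (NoDup_nth l O) Hnd) in E; lia. }
    assert (Hax : attained (dist x y)) by (exists x, y; auto).
    assert (Hsplit : forall P : nat -> Prop, P j -> (forall k, (S j <= k < i)%nat -> P k) ->
      forall k, (j <= k < i)%nat -> P k).
    { intros P P0 P1 k Hkj. destruct (Nat.eq_dec k j) as [->|]; [auto | apply P1; lia]. }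
    op. op. rewrite H6, H10. rewrite Harr by lia. fold y.
    op. rewrite H12, oracle_in by auto. op.
    op. test.
    + op. rewrite H12, oracle_in by auto. op.
      eapply (IH _ _ _ (S j)); reg; auto;
        [frame | | lra].
      intros n' r' Ha Hat Hle Hmin. peel Ha. apply Hk; auto; [lra |].
      apply Hsplit; auto.
    + op. eapply (IH _ _ _ (S j)); reg; auto;
        [frame | | lra].
      intros n' r' Ha Hat Hle Hmin. peel Ha. apply Hk; auto.
      apply Hsplit; auto. fold y. lra.
Qed.

Lemma brute_force_loop K n r v w h l f i :
  n 1%nat = 1%nat -> n 6%nat = h -> n 8%nat = length l -> (32 <= h)%nat -> array n h l ->
  n 9%nat = i -> NoDup l -> (forall y, In y l -> (y < N)%nat) ->
  (length l = f + i)%nat -> attained (r O) ->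
  (forall n' r', agree_off [9; 10; 11; 12; 13]%nat n n' -> attained (r' O) -> r' O <= r O ->
     (forall j k, (i <= j < length l)%nat -> (k < j)%nat ->
        r' O <= dist (nth j l O) (nth k l O)) -> cost K 132 n' r' w) ->
  w + (8 * INR (length l) + 8) * INR f + 2 <= v ->
  cost K 52 n r v.
Proof.
  revert n r v i; induction f as [|f IH];
    intros n r v i H1 H6 H8 Hh Harr H9 Hnd HN Hf Hatt Hk Hv.
  - op. test; [lia |]. op.
    apply (ecost_weaken _ _ _ _ _ w); [| simpl in Hv; lra].
    apply (Hk n r); [apply agree_off_refl | auto | lra | intros; lia].
  - rewrite S_INR in Hv. pose proof (pos_INR f). pose proof (pos_INR (length l)).
    op. test; [| lia].
    op. op. op. rewrite H6, H9, H1.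
    replace (h + (i + 1))%nat with (h + S i)%nat by lia. rewrite Harr by lia.
    op. eapply (inner_loop _ _ _ _ (w + (8 * INR (length l) + 8) * INR f + 2) h l _ i i O);
      reg; auto.
    3: { assert (INR i <= INR (length l)) by (apply le_INR; lia). lra. }
    + frame.
    + intros n' r' Ha Hat Hle Hmin.
      assert (H9' : n' 9%nat = S i) by (rewrite Ha by off; reg).
      apply (agree_off_incl _ [9; 10; 11; 12; 13]%nat) in Ha; [| intro; cbn [In]; tauto].
      peel Ha.
      eapply (IH _ _ _ (S i)); auto; try (rewrite Ha by off; auto; fail); try lia.
      * apply (array_agree_off [9; 10; 11; 12; 13]%nat n); auto. repeat (apply Forall_cons; [lia |]). apply Forall_nil.
      * intros n'' r'' Ha' Hat' Hle' Hmin'. apply Hk; auto; [| lra |].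
        -- eapply agree_off_trans; eauto.
        -- intros j k Hj Hkj. destruct (Nat.eq_dec j i) as [->|].
           ++ specialize (Hmin k ltac:(lia)). lra.
           ++ apply Hmin'; lia.
      * lra.
Qed.

(** Both tests are made for every point, so the points of the annulus enter both items. *)
Lemma partition_loop K n r v w h e f l p r1 r2 rest done :
  n 1%nat = 1%nat -> n 6%nat = h -> n 8%nat = length l -> n 22%nat = p ->
  r 2%nat = r1 -> r 3%nat = r2 ->
  (32 <= h)%nat -> (h + length l < e)%nat -> (e + length l < f)%nat ->
  array n h l -> l = done ++ rest -> n 9%nat = length done ->
  (p < N)%nat -> (forall y, In y l -> (y < N)%nat) ->
  let S1 := filter (within dist p r2) in
  let S2 := filter (fun x => negb (within dist p r1 x)) in
  n 25%nat = (e + length (S1 done))%nat -> array n e (S1 done) ->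
  n 26%nat = (f + length (S2 done))%nat -> array n f (S2 done) ->
  (forall n' r', agree_below e [9; 11; 12; 25; 26]%nat n n' -> r' O = r O ->
     n' 25%nat = (e + length (S1 l))%nat -> array n' e (S1 l) ->
     n' 26%nat = (f + length (S2 l))%nat -> array n' f (S2 l) -> cost K 118 n' r' w) ->
  w + 12 * INR (length rest) + 2 <= v ->
  cost K 104 n r v.
Proof.
  intros H1 H6 H8 H22 R2 R3 Hh Hhe Hef Harr Hl H9 Hp HN S1 S2 H25 A1 H26 A2 Hk Hv.
  revert n r v done H1 H6 H8 H22 R2 R3 Harr Hl H9 H25 A1 H26 A2 Hk Hv;
    induction rest as [|x rest IH];
    intros n r v done H1 H6 H8 H22 R2 R3 Harr Hl H9 H25 A1 H26 A2 Hk Hv.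
  - rewrite app_nil_r in Hl. subst done. op. test; [lia |]. op.
    eapply ecost_weaken; [apply (Hk n r); auto; intros a _ _; reflexivity | simpl in Hv; lra].
  - cbn [length] in Hv. rewrite S_INR in Hv. pose proof (pos_INR (length rest)).
    assert (Hlen : length l = (length done + S (length rest))%nat)
      by (rewrite Hl, length_app; reflexivity).
    assert (L1 : (length (S1 done) <= length done)%nat) by apply filter_length_le.
    assert (L2 : (length (S2 done) <= length done)%nat) by apply filter_length_le.
    assert (Hx : nth (length done) l O = x)
      by (rewrite Hl, app_nth2, Nat.sub_diag by lia; reflexivity).
    assert (HxN : (x < N)%nat) by (apply HN; rewrite Hl; apply in_elt).
    op. test; [| lia]. op. op. op. rewrite H6, H9, H1.
    replace (h + (length done + 1))%nat with (h + S (length done))%nat by lia.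
    rewrite Harr, Hx by lia.
    op. rewrite H22, oracle_in by auto.
    assert (Hl' : l = (done ++ [x]) ++ rest) by (rewrite <- app_assoc; exact Hl).
    assert (E1 : S1 (done ++ [x]) = S1 done ++ (if within dist p r2 x then [x] else []))
      by (unfold S1; rewrite filter_app; simpl; destruct (within dist p r2 x); reflexivity).
    assert (E2 : S2 (done ++ [x]) = S2 done ++ (if within dist p r1 x then [] else [x]))
      by (unfold S2; rewrite filter_app; simpl; destruct (within dist p r1 x); reflexivity).
    unfold within in E1, E2.
    op. rewrite R3. test; [| op; op].
    all: op; rewrite R2; test.
    (* These branches append to the second item. Selecting them moves them to the front, so the
       other two come third and fourth. *)
    1, 3: op; op; op.
    3, 4: op.
    all: destruct (Rlt_dec r2 (dist p x)) in E1; try contradiction.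
    all: destruct (Rlt_dec r1 (dist p x)) in E2; try contradiction.
    all: eapply (IH _ _ _ (done ++ [x])); reg; auto; try lra;
      rewrite ?E1, ?E2, ?app_nil_r, ?length_app; cbn [length]; try lia; try (frame; fail);
      try append.
    all: intros n' r' Ha; peel_below Ha; apply Hk; auto.
Qed.

Lemma psum_indicator (g : nat -> bool) (x y : R) n :
  psum (fun i => if g i then x else y) n =
  INR n * y - (y - x) * INR (nsum (fun i => if g i then 1 else 0) n)%nat.
Proof.
  induction n as [|n IH]; [simpl; ring |].
  cbn [psum nsum]. rewrite IH, S_INR, plus_INR. destruct (g n); simpl; ring.
Qed.

(** A trial succeeds with probability at least m ^ 2 / B ^ 2. Success continues at cost w, failure
    returns to the loop head at cost v, so v is sustainable once (v - w) m ^ 2 / B ^ 2 covers the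
    cost of one trial. *)
Lemma trial_loop n0 delta h e l b s m w v K n r :
  constants n0 -> n0 6%nat = h -> n0 7%nat = e -> n0 8%nat = length l ->
  n0 14%nat = (2 ^ b)%nat -> n0 16%nat = (2 ^ s)%nat -> n0 18%nat = m ->
  (32 <= h)%nat -> (h + N < e)%nat -> array n0 h l ->
  (forall y, In y l -> (y < N)%nat) -> (length l <= N)%nat -> (1 <= m)%nat ->
  (m * m * 2 ^ s <=
     nsum (fun z => if trial_accepts dist l m (2 ^ b) (2 ^ s) z then 1 else 0)
       (2 ^ s * 2 ^ b * 2 ^ b))%nat ->
  (forall n' r' p q k, agree_below e (7%nat :: trial_registers) n0 n' -> r' O = delta ->
     In p l -> In q l -> (k < 2 ^ s)%nat -> accepts dist l m (2 ^ s) p q k = true ->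
     let S1 := filter (within dist p (annulus_inner dist p q (S k) (2 ^ s))) l in
     let S2 := filter (fun x => negb (within dist p (annulus_inner dist p q k (2 ^ s)) x)) l in
     n' 7%nat = (e + M + M)%nat -> n' e = length S1 -> array n' e S1 ->
     n' (e + M)%nat = length S2 -> array n' (e + M) S2 ->
     cost K 132 n' r' w) ->
  0 <= w ->
  (12 * INR (length l) + 6 * INR (s + b + b) + 60) * INR (2 ^ b * 2 ^ b) <=
    (v - w) * INR (m * m) ->
  agree_below e trial_registers n0 n -> r O = delta ->
  cost K 68 n r v.
Proof.
  intros HC H6 H7 H8 H14 H16 H18 Hh Hhe Harr HN Hln Hm Hacc Hk Hw Hv.
  assert (HB : (1 <= 2 ^ b)%nat) by (apply Nat.neq_0_lt_0, Nat.pow_nonzero; lia).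
  assert (HT : (1 <= 2 ^ s)%nat) by (apply Nat.neq_0_lt_0, Nat.pow_nonzero; lia).
  set (A := 12 * INR (length l) + 6 * INR (s + b + b) + 60) in Hv.
  assert (HA : 60 <= A)
    by (unfold A; pose proof (pos_INR (length l)); pose proof (pos_INR (s + b + b)); lra).
  assert (Hvw : w <= v).
  { apply Rnot_lt_le. intro Hlt.
    assert (0 < INR (m * m)) by (apply lt_0_INR; nia).
    assert (0 <= INR (2 ^ b * 2 ^ b)) by apply pos_INR. nra. }
  destruct HC as (C0 & C1 & C2 & C3 & C5 & _ & _).
  revert n r; induction K as [|K IH]; intros n r Hn Hr.
  { split; [discriminate | split; [lra | exact I]]. }
  assert (IHK : forall n r u, agree_below e trial_registers n0 n -> r O = delta -> v <= u ->
    cost K 68 n r u).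
  { intros n' r' u Ha Hr' Hu. eapply ecost_weaken; [apply IH; auto | exact Hu].
    intros n1 r1 p q k. intros. apply ecost_pred. apply (Hk n1 r1 p q k); assumption. }
  clear IH.
  apply ecost_step_later; [reflexivity | intro bit].
  change (ecost closest_pair orc Post K
    (step closest_pair orc bit (mkConfig 68 n r)) (v - 1)) with
    (cost K 69 (updn n 19 0%nat) r (v - 1)).
  assert (E2 : n 2%nat = 2%nat) by (rewrite Hn by off; auto).
  assert (E14 : n 14%nat = (2 ^ b)%nat) by (rewrite Hn by off; auto).
  assert (E16 : n 16%nat = (2 ^ s)%nat) by (rewrite Hn by off; auto).
  op. op. op.
  (* The cost of a trial once its number is drawn. *)
  set (u := 12 * INR (length l) + 50).
  apply (bits_loop (fun z => if trial_accepts dist l m (2 ^ b) (2 ^ s) z then w + u else v + u)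
    K _ _ _ (s + b + b) 0 0); reg; [reflexivity | | |].
  { rewrite E14, E16, !Nat.pow_add_r, Nat.pow_0_r. lia. }
  2: { rewrite (psum_ext _ (fun z => if trial_accepts dist l m (2 ^ b) (2 ^ s) z
          then w + u else v + u)) by (intros i _; rewrite Nat.mul_1_l; reflexivity).
       rewrite psum_indicator, (Nat.pow_add_r 2 (s + b)), (Nat.pow_add_r 2 s).
       set (acc := nsum _ _) in *.
       replace (2 ^ (s + b + b)) with (INR (2 ^ s * 2 ^ b * 2 ^ b))
         by (rewrite <- !Nat.pow_add_r, pow_INR; reflexivity).
       set (Z := (2 ^ s * 2 ^ b * 2 ^ b)%nat) in *.
       assert (HZ : 0 < INR Z) by (apply lt_0_INR; unfold Z; nia).
       assert (HAZ : A * INR Z <= (v - w) * INR acc).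
       { apply Rle_trans with ((v - w) * INR (m * m * 2 ^ s));
           [| apply Rmult_le_compat_l; [lra | apply le_INR, Hacc]].
         unfold Z. rewrite (mult_INR (m * m)), <- Nat.mul_assoc, (mult_INR (2 ^ s)).
         pose proof (pos_INR (2 ^ s)). nra. }
       assert (HAZ' : A <= (v - w) * INR acc / INR Z).
       { apply Rmult_le_reg_r with (INR Z); auto.
         unfold Rdiv. rewrite Rmult_assoc, Rinv_l; lra. }
       replace ((INR Z * (v + u) - (v + u - (w + u)) * INR acc) / INR Z)
         with (v + u - (v - w) * INR acc / INR Z) by (field; lra).
       unfold u, A in *. lra. }
  intros n1 z _ Hn1 Hz. rewrite Nat.mul_1_l, Nat.add_0_l in *.
  apply (agree_off_incl _ trial_registers) in Hn1; [| intro; cbn [In trial_registers]; tauto].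
  peel Hn1. apply (agree_off_below e), (agree_below_trans _ _ _ _ _ Hn) in Hn1.
  clear n Hn E2 E14 E16.
  assert (E0 : n1 0%nat = N) by (rewrite Hn1 by off; auto).
  assert (E1 : n1 1%nat = 1%nat) by (rewrite Hn1 by off; auto).
  assert (E2 : n1 2%nat = 2%nat) by (rewrite Hn1 by off; auto).
  assert (E5 : n1 5%nat = M) by (rewrite Hn1 by off; auto).
  assert (E6 : n1 6%nat = h) by (rewrite Hn1 by off; auto).
  assert (E7 : n1 7%nat = e) by (rewrite Hn1 by off; auto).
  assert (E8 : n1 8%nat = length l) by (rewrite Hn1 by off; auto).
  assert (E14 : n1 14%nat = (2 ^ b)%nat) by (rewrite Hn1 by off; auto).
  assert (E16 : n1 16%nat = (2 ^ s)%nat) by (rewrite Hn1 by off; auto).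
  assert (E18 : n1 18%nat = m) by (rewrite Hn1 by off; auto).
  assert (Harr1 : array n1 h l).
  { apply (array_agree_below e trial_registers n0); auto; [| lia].
    unfold trial_registers. repeat (apply Forall_cons; [lia |]). apply Forall_nil. }
  op. op. op. op. rewrite Hz, E14, E16.
  set (k := (z mod 2 ^ s)%nat). set (iq := (z / 2 ^ s mod 2 ^ b)%nat).
  set (ip := (z / 2 ^ s / 2 ^ b)%nat).
  assert (Hk' : (k < 2 ^ s)%nat) by (apply Nat.mod_upper_bound; lia).
  unfold trial_accepts. cbv zeta. fold k iq ip.
  assert (Hu : 50 <= u) by (unfold u; pose proof (pos_INR (length l)); lra).
  op. rewrite E8. test.
  2: { op. cbn [andb].
       apply IHK; auto; [| lra].
       intros a Ha Hs. rewrite <- Hn1 by auto. cbn [updn]. cbn [In trial_registers] in Hs. addresses. reflexivity. }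
  op. rewrite E8. test.
  2: { op. cbn [andb].
       apply IHK; auto; [| lra].
       intros a Ha Hs. rewrite <- Hn1 by auto. cbn [updn]. cbn [In trial_registers] in Hs. addresses. reflexivity. }
  cbn [andb].
  set (p := nth ip l O). set (q := nth iq l O).
  assert (Hp : In p l) by (apply nth_In; auto).
  assert (Hq : In q l) by (apply nth_In; auto).
  op. op. op. rewrite E6, E1. replace (ip + h + 1)%nat with (h + S ip)%nat by lia.
  rewrite Harr1 by auto. fold p.
  op. op. op. rewrite E6, E1. replace (iq + h + 1)%nat with (h + S iq)%nat by lia.
  rewrite Harr1 by auto. fold q.
  op. rewrite oracle_in by auto.
  op. op. op. op. op. op. op. op. op. op.
  rewrite E16.
  change (INR k * (dist p q / INR (2 ^ s)) + dist p q) with (annulus_inner dist p q k (2 ^ s)).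
  rewrite <- annulus_inner_S.
  set (r1 := annulus_inner dist p q k (2 ^ s)). set (r2 := annulus_inner dist p q (S k) (2 ^ s)).
  assert (HM : M = (32 + N)%nat) by reflexivity.
  apply (partition_loop K _ _ _ ((if accepts dist l m (2 ^ s) p q k then w else v) + 20)
    h e (e + M) l p r1 r2 l []); reg; auto; try (frame; fail).
  { rewrite E7, E1. cbn [filter length]. lia. }
  { intros i Hi. inversion Hi. }
  { rewrite E7, E5, E1. cbn [filter length]. lia. }
  { intros i Hi. inversion Hi. }
  2: { unfold u. destruct (accepts dist l m (2 ^ s) p q k); lra. }
  intros n2 r' Ha Hr' H25 A1 H26 A2.
  assert (E29 : n2 29%nat = (e + M)%nat) by (rewrite Ha by off; reg).
  apply (agree_below_incl _ _ trial_registers) in Ha; [| intro; cbn [In trial_registers]; tauto].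
  peel_below Ha. apply (agree_below_trans _ _ _ _ _ Hn1) in Ha.
  clear Hn1 E0 E1 E2 E5 E6 E7 E8 E14 E16 E18 Harr1.
  assert (E2 : n2 2%nat = 2%nat) by (rewrite Ha by off; auto).
  assert (E5 : n2 5%nat = M) by (rewrite Ha by off; auto).
  assert (E7 : n2 7%nat = e) by (rewrite Ha by off; auto).
  assert (E8 : n2 8%nat = length l) by (rewrite Ha by off; auto).
  assert (E16 : n2 16%nat = (2 ^ s)%nat) by (rewrite Ha by off; auto).
  assert (E18 : n2 18%nat = m) by (rewrite Ha by off; auto).
  pose proof (filter_negb_length (within dist p r1) l) as Hneg.
  set (c1 := length (filter (within dist p r2) l)) in *.
  set (c2 := length (filter (fun x => negb (within dist p r1 x)) l)) in *.
  (* The program never counts the inner ball; it infers the size of the annulus from the overlap of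
     the two parts. *)
  assert (Hsub : (c1 + c2 - length l = c1 - ball_count dist l p r1)%nat)
    by (unfold ball_count; lia).
  assert (Hspec : accepts dist l m (2 ^ s) p q k = true <->
    (2 * c1 <= length l /\ c2 + m <= length l /\
     (c1 + c2 - length l) * 2 ^ s <= 2 * length l)%nat).
  { rewrite Hsub. unfold accepts. fold r1 r2. rewrite !Bool.andb_true_iff, !Nat.leb_le.
    change (ball_count dist l p r2) with c1. unfold ball_count in *. lia. }
  op. op. rewrite H25, H26, E7, E29.
  replace (e + c1 - e)%nat with c1 by lia.
  replace (e + M + c2 - (e + M))%nat with c2 by lia.
  op. rewrite E2.
  op. rewrite E8. test; [reject Hspec IHK Ha |].
  op. rewrite E18. op. rewrite E8. test; [reject Hspec IHK Ha |].
  op. op. rewrite E8. op. rewrite E16. op. rewrite E8, E2. op. test; [reject Hspec IHK Ha |].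
  destruct (accepts dist l m (2 ^ s) p q k) eqn:EA.
  2: { assert (false = true) by (apply Hspec; lia). discriminate. }
  op. rewrite E7. op. rewrite E29. op. rewrite E29, E5.
  eapply ecost_weaken;
    [apply ecost_pred; apply (Hk _ _ p q k); auto; reg; auto; try (frame; fail) | lra].
  - intros a Hlt Hs. rewrite <- Ha by (cbn [In trial_registers] in *; tauto). cbn [updn].
    cbn [In trial_registers] in Hs. addresses. reflexivity.
  - congruence.
  - assert (length (filter (within dist p (annulus_inner dist p q (S k) (2 ^ s))) l)
      <= length l)%nat by apply filter_length_le.
    frame.
Qed.

(** The machine has no real powers, so 2 ^ d is replaced by the power 2 ^ D of the least natural D
    not below d. *)
Lemma dimension_loop K n r v w d D f j :
  (forall i, (i < D)%nat -> INR i < d) -> d <= INR D ->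
  n 1%nat = 1%nat -> n 2%nat = 2%nat -> n 3%nat = (2 ^ j)%nat -> n 4%nat = j -> r O = d ->
  (f + j = D)%nat ->
  (forall n' r', agree_off [3; 4]%nat n n' -> n' 3%nat = (2 ^ D)%nat -> cost K 10 n' r' w) ->
  w + 5 * INR f + 3 <= v ->
  cost K 4 n r v.
Proof.
  intros HD1 HD2.
  revert n r v j; induction f as [|f IH]; intros n r v j H1 H2 H3 H4 Hr Hf Hk Hv.
  - simpl in Hv. replace j with D in * by lia. op. op. rewrite H4, Hr. test; [lra |]. op.
    eapply ecost_weaken; [apply Hk; auto using agree_off_refl | lra].
  - rewrite S_INR in Hv. pose proof (pos_INR f).
    specialize (HD1 j ltac:(lia)) as Hj.
    op. op. rewrite H4, Hr. test; [| lra]. op. op. op.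
    eapply (IH _ _ _ (S j)); reg; auto; try lra.
    + rewrite H3, H2. simpl. lia.
    + intros n' r' Ha. peel Ha. auto.
Qed.

Lemma fill_loop K n r v w a f i :
  n 0%nat = N -> n 1%nat = 1%nat -> n 9%nat = i -> n 11%nat = (a + S i)%nat -> (32 <= a)%nat ->
  (f + i = N)%nat -> array n a (seq 0 i) ->
  (forall n', agree_below (S a) [9; 11]%nat n n' -> array n' a (seq 0 N) -> cost K 29 n' r w) ->
  w + 5 * INR f + 2 <= v ->
  cost K 23 n r v.
Proof.
  revert n v i; induction f as [|f IH]; intros n v i H0 H1 H9 H11 Ha Hf Harr Hk Hv.
  - simpl in Hv. replace i with N in * by lia. op. test; [lia |]. op.
    eapply ecost_weaken; [apply Hk; auto; intros b _ _; reflexivity | lra].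
  - rewrite S_INR in Hv. pose proof (pos_INR f).
    op. test; [| lia]. op. rewrite H11, H9. op. op. op.
    eapply (IH _ _ (S i)); reg; try lra.
    + rewrite seq_S. cbn [Nat.add]. frame.
      replace (a + S i)%nat with (a + S (length (seq 0 i)))%nat by (rewrite length_seq; lia).
      apply array_updn_snoc, Harr.
    + intros n' Hn. peel_below Hn. auto.
Qed.

(** * The queue of items and the main loop *)

Fixpoint queue (n : nat -> nat) (a : nat) (Q : list (list nat)) : Prop :=
  match Q with
  | [] => True
  | l :: Q' => n a = length l /\ array n a l /\ queue n (a + M) Q'
  end.

Definition valid (l : list nat) : Prop :=
  NoDup l /\ (forall x, In x l -> (x < N)%nat) /\ (1 <= length l)%nat.

Lemma valid_length l : valid l -> (length l <= N)%nat.
Proof.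
  intros (Hnd & HN & _). rewrite <- (length_seq N 0). apply NoDup_incl_length; auto.
  intros x Hx. apply in_seq. specialize (HN x Hx). lia.
Qed.

Lemma queue_ext n n' a Q :
  Forall valid Q ->
  (forall b, (a <= b < a + M * length Q)%nat -> n' b = n b) ->
  queue n a Q -> queue n' a Q.
Proof.
  revert a; induction Q as [|l Q IH]; intros a HV H HQ; [exact I |].
  inversion HV as [|? ? Hl HV']; subst. apply valid_length in Hl.
  destruct HQ as (H1 & H2 & H3). cbn [length] in H.
  assert (HM : M = (32 + N)%nat) by reflexivity.
  split; [rewrite H by lia; auto | split].
  - intros i Hi. rewrite H by lia. auto.
  - apply IH; auto. intros b Hb. apply H. lia.
Qed.

Lemma queue_app n a Q Q' :
  queue n a Q -> queue n (a + M * length Q) Q' -> queue n a (Q ++ Q').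
Proof.
  revert a; induction Q as [|l Q IH]; intros a HQ HQ'.
  - cbn [length] in HQ'. rewrite Nat.mul_0_r, Nat.add_0_r in HQ'. exact HQ'.
  - destruct HQ as (H1 & H2 & H3). cbn [app]. split; [| split]; auto.
    apply IH; auto. cbn [length] in HQ'.
    replace (a + M + M * length Q)%nat with (a + M * S (length Q))%nat by lia. exact HQ'.
Qed.

Definition pending (Q : list (list nat)) : Prop :=
  exists l x y, In l Q /\ In x l /\ In y l /\ x <> y /\
    forall a b, (a < N)%nat -> (b < N)%nat -> a <> b -> dist x y <= dist a b.

Fixpoint weight (c : R) (Q : list (list nat)) : R :=
  match Q with [] => 0 | l :: Q' => c * phi (length l) + weight c Q' end.

Lemma weight_app c Q Q' : weight c (Q ++ Q') = weight c Q + weight c Q'.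
Proof. induction Q as [|l Q IH]; simpl; [| rewrite IH]; ring. Qed.

Lemma weight_nonneg c Q : 0 <= c -> Forall valid Q -> 0 <= weight c Q.
Proof.
  intros Hc; induction 1 as [|l Q (_ & _ & Hl) _ IH]; simpl; [lra |].
  pose proof (phi_ge _ Hl). pose proof (pos_INR (length l)). nra.
Qed.

Definition invariant (n : nat -> nat) (r : nat -> R) (h : nat) (Q : list (list nat)) : Prop :=
  constants n /\ (32 <= h)%nat /\ n 6%nat = h /\ n 7%nat = (h + M * length Q)%nat /\
  queue n h Q /\ Forall valid Q /\ attained (r O) /\ (Post (r O) \/ pending Q).

(** Splitting and brute force both end in this code, which returns to the main loop. *)
Lemma pop K c n r v h Q :
  (forall n r h v, invariant n r h Q -> weight c Q + 2 <= v -> cost K 31 n r v) ->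
  constants n -> (32 <= h)%nat -> n 6%nat = h -> n 7%nat = (h + M + M * length Q)%nat ->
  queue n (h + M) Q -> Forall valid Q -> attained (r O) -> (Post (r O) \/ pending Q) ->
  weight c Q + 4 <= v -> cost K 132 n r v.
Proof.
  intros HK HC Hh H6 H7 HQ HV Hat HP Hv.
  assert (HC' := HC). destruct HC' as (C0 & C1 & C2 & C3 & C5 & C27 & C28).
  op. op. rewrite H6, C5. apply (HK _ _ (h + M)%nat); [| lra].
  repeat split; auto; reg.
  apply (queue_ext n); auto. intros b Hb. cbn [updn]. addresses. reflexivity.
Qed.

Lemma trial_budget X x bR sR tR mR BR gain :
  1 <= X -> 1 <= x -> 0 <= bR <= 2 * x -> tR = 64 * X * bR -> 0 <= sR <= 2 * tR + 1 ->
  0 <= mR -> x <= 8 * X * mR -> 0 <= BR <= 2 * x ->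
  500000 * (X * X * X) * x - 10 * x - 10 * tR - 40 <= gain ->
  (12 * x + 6 * (sR + bR + bR) + 60) * (BR * BR) <= gain * (mR * mR).
Proof.
  intros HX Hx Hb Ht Hs Hm Hxm HB Hg.
  assert (HXx : x <= X * x) by nra.
  assert (Ht' : tR <= 128 * (X * x)) by (subst tR; nra).
  (* As sR is at most 256 X x + 1, the constant is 12 + 6 (257) + 24 + 60. *)
  assert (HA : 12 * x + 6 * (sR + bR + bR) + 60 <= 1638 * (X * x)) by lra.
  assert (HX2 : 1 <= X * X) by nra.
  assert (HX3 : X * x <= X * X * X * x) by nra.
  assert (HG : 256 * (X * X) * (1638 * (X * x)) <= gain) by nra.
  assert (HB2 : BR * BR <= 256 * (X * X) * (mR * mR)).
  { assert (BR <= 16 * X * mR) by lra.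
    replace (256 * (X * X) * (mR * mR)) with ((16 * X * mR) * (16 * X * mR)) by ring.
    apply Rmult_le_compat; lra. }
  apply Rle_trans with (1638 * (X * x) * (256 * (X * X) * (mR * mR))).
  - apply Rmult_le_compat; try lra. apply Rmult_le_pos; lra.
  - replace (1638 * (X * x) * (256 * (X * X) * (mR * mR))) with
      (256 * (X * X) * (1638 * (X * x)) * (mR * mR)) by ring.
    apply Rmult_le_compat_r; [nra | exact HG].
Qed.

Section Costs.

Variables (c : R) (n0 : nat).
Hypothesis metric : is_metric N dist.
Hypothesis covers : doubling_covers N dist L.
Hypothesis L_pos : (1 <= L)%nat.
Hypothesis brute_force_small : forall n b s,
  (2 ^ b <= 2 * n)%nat -> (n <= 2 ^ b)%nat -> (2 ^ s <= 128 * L ^ 4 * b + 1)%nat ->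
  (n / (4 * L ^ 4) <= L ^ (s + 2))%nat -> (n <= n0)%nat.
(** The first term pays for the trials out of the drop n / (16 L ^ 4) of the potential, 8000000
    being 16 times the 500000 of [trial_budget]. The second pays for the quadratic brute force on at
    most n0 points, the third for the loops computing B and T. *)
Hypothesis c_large :
  8000000 * INR L ^ 16 + 8 * INR n0 + 2000 * INR L ^ 4 <= c.

Lemma attained_le_closest delta delta' :
  attained delta' -> delta' <= delta -> Post delta -> Post delta'.
Proof.
  intros Ha Hle [_ Hp]. split; [exact Ha |]. intros x y Hx Hy Hxy.
  specialize (Hp x y Hx Hy Hxy). lra.
Qed.

Lemma main_loop K n r v h Q :
  invariant n r h Q -> weight c Q + 2 <= v -> cost K 31 n r v.
Proof.
  assert (HL4 : (1 <= L ^ 4)%nat) by (apply Nat.neq_0_lt_0, Nat.pow_nonzero; lia).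
  assert (HX : 1 <= INR L ^ 4) by (rewrite <- pow_INR; apply (le_INR 1); auto).
  set (X := INR L ^ 4) in *.
  assert (HX4 : INR L ^ 16 = X * X * X * X) by (unfold X; ring).
  rewrite HX4 in c_large.
  assert (HX2 : 1 <= X * X) by (clear - HX; nra).
  assert (HXX : 1 <= X * X * X * X) by (clear - HX HX2; nra).
  assert (Hc0 : 0 <= c) by (pose proof (pos_INR n0); lra).
  revert n r v h Q; induction K as [|K IH]; intros n r v h Q HI Hv.
  { split; [discriminate |]. split; [| exact I].
    destruct HI as (_ & _ & _ & _ & _ & HV & _ & _).
    pose proof (weight_nonneg c Q Hc0 HV). lra. }
  destruct HI as (HC & Hh & H6 & H7 & HQ & HV & Hat & HP).
  assert (HM : M = (32 + N)%nat) by reflexivity.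
  apply ecost_step_later; [reflexivity | intro bit].
  change (ecost closest_pair orc Post K
    (step closest_pair orc bit (mkConfig 31 n r)) (v - 1)) with
    (cost K (if (n 6 <? n 7)%nat then 33 else 32)%nat n r (v - 1)).
  destruct Q as [|l Q].
  { cbn [length weight] in *. test; [lia |]. apply ecost_halt; [reflexivity | | lra].
    destruct HP as [HP | (l & ? & ? & [] & _)]. exact HP. }
  inversion HV as [|? ? Hl HV']; subst.
  pose proof (valid_length l Hl) as HlN.
  destruct Hl as (Hnd & HlN' & Hl1). destruct HQ as (Hql & Harr & HQ).
  cbn [length weight] in *.
  assert (HC' := HC). destruct HC' as (C0 & C1 & C2 & C3 & C5 & C27 & C28).
  test; [| lia].
  set (e := (n 6 + M + M * length Q)%nat).
  set (x := INR (length l)).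
  assert (Hx1 : 1 <= x) by (apply (le_INR 1); auto).
  set (wl := weight c Q) in *.
  op. op. op.
  rewrite Hql.
  apply (log_loop K _ _ _ (v - 6 - 10 * x) (length l) (2 * length l) 0); reg;
    [reflexivity | simpl; lia | | rewrite mult_INR; fold x; simpl (INR 2); lra].
  intros n1 b Hn1 E14 E15 Hb2 Hlb.
  apply (agree_off_incl _ [14; 15; 16; 17; 18; 30]%nat) in Hn1; [| intro; cbn [In]; tauto].
  do 2 (apply agree_off_updn in Hn1; [| cbn [In]; lia]).
  assert (F2 : n1 2%nat = 2%nat) by (rewrite Hn1 by off; reg).
  assert (F3 : n1 3%nat = L) by (rewrite Hn1 by off; reg).
  assert (F28 : n1 28%nat = (64 * L ^ 4)%nat) by (rewrite Hn1 by off; reg).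
  op. op. op. rewrite F28, E15.
  set (t := (64 * L ^ 4 * b)%nat).
  set (tR := 64 * X * INR b).
  assert (HtR : INR t = tR).
  { unfold t, tR, X. rewrite !mult_INR, pow_INR. simpl (INR 64). lra. }
  apply (annulus_loop K _ _ _ (v - 21 - 10 * x - 10 * tR) t (2 * t + 2) 0); reg;
    [reflexivity | rewrite F3; simpl; lia | simpl; lia | |
     rewrite plus_INR, mult_INR, HtR; simpl (INR 2); lra].
  intros n2 s Hn2 E16 E17 Hs2 Hst.
  assert (E14' : n2 14%nat = (2 ^ b)%nat) by (rewrite Hn2 by off; reg).
  apply (agree_off_incl _ [14; 15; 16; 17; 18; 30]%nat) in Hn2; [| intro; cbn [In]; tauto].
  peel Hn2. apply (agree_off_trans _ _ _ _ Hn1) in Hn2. clear n1 Hn1 E14 E15 F2 F3 F28.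
  assert (F8 : n2 8%nat = length l) by (rewrite Hn2 by off; reg).
  assert (F27 : n2 27%nat = (4 * L ^ 4)%nat) by (rewrite Hn2 by off; reg).
  op. rewrite F8, F27. set (m := (length l / (4 * L ^ 4))%nat).
  op. rewrite E17.
  set (n3 := updn n2 18 m).
  assert (Hn : forall a, ~ In a [8; 14; 15; 16; 17; 18; 30]%nat -> n3 a = n a).
  { intros a Ha. cbn [In] in Ha. unfold n3. cbn [updn]. addresses.
    rewrite Hn2 by off. reg. }
  assert (HC3 : constants n3) by (repeat split; rewrite Hn by off; auto).
  assert (G6 : n3 6%nat = n 6%nat) by (apply Hn; off).
  assert (G7 : n3 7%nat = e) by (rewrite Hn by off; unfold e; lia).
  assert (G8 : n3 8%nat = length l) by exact F8.
  assert (G14 : n3 14%nat = (2 ^ b)%nat) by exact E14'.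
  assert (G16 : n3 16%nat = (2 ^ s)%nat) by exact E16.
  assert (G18 : n3 18%nat = m) by reflexivity.
  assert (Harr3 : array n3 (n 6%nat) l) by (intros i Hi; rewrite Hn by off; auto).
  assert (HQ3 : queue n3 (n 6 + M)%nat Q).
  { apply (queue_ext n); auto. intros a Ha. apply Hn. off. }
  clearbody n3. clear n2 Hn2 Hn F8 F27 E14' E16 E17.
  test.
  - assert (Hm1 : (1 <= L ^ (s + 2))%nat) by (apply Nat.neq_0_lt_0, Nat.pow_nonzero; lia).
    set (gain := c * (x / (16 * X))).
    assert (Hphi := phi_ge _ Hl1). fold x in Hphi.
    assert (Hxm : (length l <= 8 * L ^ 4 * m)%nat).
    { unfold m in *. pose proof (Nat.mul_succ_div_gt (length l) (4 * L ^ 4)). nia. }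
    assert (Hmm : (4 * L ^ 4 * m <= length l)%nat) by apply Nat.Div0.mul_div_le.
    assert (Hbl : (1 <= b)%nat).
    { destruct b; [|lia]. exfalso. change (2 ^ 0)%nat with 1%nat in *. nia. }
    assert (Hgain : gain <= c * phi (length l)).
    { apply Rmult_le_compat_l; auto. apply Rle_trans with x; auto.
      apply Rmult_le_reg_r with (16 * X); [lra |].
      unfold Rdiv. rewrite Rmult_assoc, Rinv_l by lra. nra. }
    assert (Hgain' : 500000 * (X * X * X) * x <= gain).
    { unfold gain. apply Rmult_le_reg_r with (16 * X); [lra |].
      replace (c * (x / (16 * X)) * (16 * X)) with (c * x) by (field; lra).
      replace (500000 * (X * X * X) * x * (16 * X)) with (8000000 * (X * X * X * X) * x) by ring.
      apply Rmult_le_compat_r; [lra |]. pose proof (pos_INR n0). lra. }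
    pose proof (weight_nonneg c Q Hc0 HV') as Hwl. fold wl in Hwl.
    (* After the split the queue weighs [gain] less; [v + 2 - gain] covers it together with the 4 of
       [pop], and the rest of [gain] is for the trials. *)
    apply (trial_loop n3 (r O) (n 6%nat) e l b s m (v + 2 - gain)); auto;
      try (unfold e; lia); try lia; try lra.
    + apply many_trials_accepted with (N := N) (L := L); auto; try lia.
    + intros n' r' p q k Ha Hr' Hp Hq Hk Hacc S1 S2 G7' Q1 A1 Q2 A2.
      unfold accepts in Hacc. rewrite !Bool.andb_true_iff, !Nat.leb_le in Hacc.
      destruct Hacc as [[T1 T2] T3].
      assert (L1 : length S1 = ball_count dist l p (annulus_inner dist p q (S k) (2 ^ s)))
        by reflexivity.
      assert (L2 : (ball_count dist l p (annulus_inner dist p q k (2 ^ s)) + length S2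
        = length l)%nat) by apply filter_negb_length.
      assert (Hmono : (ball_count dist l p (annulus_inner dist p q k (2 ^ s)) <=
        ball_count dist l p (annulus_inner dist p q (S k) (2 ^ s)))%nat).
      { apply ball_count_mono. rewrite annulus_inner_S.
        enough (0 <= dist p q / INR (2 ^ s)) by lra.
        apply Rmult_le_pos; [apply (dist_nonneg N); auto |].
        apply Rlt_le, Rinv_0_lt_compat, lt_0_INR, Nat.neq_0_lt_0, Nat.pow_nonzero. lia. }
      assert (V1 : valid S1).
      { split; [apply NoDup_filter, Hnd | split; [| lia]].
        intros y Hy. apply filter_In in Hy. apply HlN', Hy. }
      assert (V2 : valid S2).
      { split; [apply NoDup_filter, Hnd | split; [| lia]].
        intros y Hy. apply filter_In in Hy. apply HlN', Hy. }
      assert (V' : Forall valid (Q ++ [S1; S2])) by (apply Forall_app; auto).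
      assert (HC' : constants n').
      { destruct HC3 as (D0 & D1 & D2 & D3 & D5 & D27 & D28).
        repeat split; rewrite Ha by off; auto. }
      apply (pop K c _ _ _ (n 6%nat) (Q ++ [S1; S2])); auto.
      * intros. eapply IH; eauto.
      * rewrite Ha by off. exact G6.
      * rewrite G7', length_app. cbn [length]. unfold e. lia.
      * apply queue_app; [| cbn [queue]; fold e; auto].
        apply (queue_ext n3); auto. intros a Hla. apply Ha; [unfold e; lia | off].
      * rewrite Hr'. exact Hat.
      * rewrite Hr'. destruct HP as [HP | (l' & x' & y' & Hl' & Hx' & Hy' & Hxy & Hmin)];
          [left; exact HP | right].
        destruct Hl' as [<- | Hl'].
        2: { exists l', x', y'. repeat split; auto. apply in_or_app; auto. }
        destruct (closest_pair_not_split N dist L metric covers l HlN' Hnd m s p q k x' y')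
          as [[W1 W2] | [W1 W2]]; auto; try lia.
        -- exists S1, x', y'. repeat split; auto.
           ++ apply in_or_app. right. simpl. auto.
           ++ apply filter_In; auto.
           ++ apply filter_In; auto.
        -- exists S2, x', y'. repeat split; auto.
           ++ apply in_or_app. right. simpl. auto.
           ++ apply filter_In. rewrite W1. auto.
           ++ apply filter_In. rewrite W2. auto.
      * rewrite weight_app. cbn [weight]. fold wl.
        assert (Hsp : phi (length S1) + phi (length S2) <= phi (length l) - x / (16 * X)).
        { apply (split_potential L (length l) b (2 ^ s)); auto; try lia; fold m; try lia. }
        apply (Rmult_le_compat_l c) in Hsp; auto. unfold gain. lra.
    + rewrite !mult_INR, !plus_INR.
      apply (trial_budget X x (INR b) (INR s) tR); auto; try apply pos_INR.
      * split; [apply pos_INR |]. unfold x. rewrite <- (mult_INR 2). apply le_INR.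
        pose proof (Nat.pow_gt_lin_r 2 b ltac:(lia)). lia.
      * split; [apply pos_INR |]. rewrite <- HtR, <- (mult_INR 2), <- (plus_INR _ 1). apply le_INR.
        pose proof (Nat.pow_gt_lin_r 2 s ltac:(lia)). lia.
      * apply le_INR in Hxm. rewrite !mult_INR, pow_INR in Hxm. fold X x in Hxm.
        replace (INR 8) with 8 in Hxm by (simpl; lra). exact Hxm.
      * split; [apply pos_INR |]. unfold x. rewrite <- (mult_INR 2). apply le_INR. exact Hb2.
      * lra.
    + intros a _ _; reflexivity.
  - assert (Hsmall : (length l <= n0)%nat).
    { apply (brute_force_small _ b s); auto. unfold t in Hs2. lia. }
    assert (Hphi := phi_ge _ Hl1). fold x in Hphi.
    assert (Hx0 : x <= INR n0) by (apply le_INR, Hsmall).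
    assert (HtR' : tR <= 128 * (X * x)).
    { assert (Hbx : INR b <= 2 * x).
      { unfold x. rewrite <- (mult_INR 2). apply le_INR.
        pose proof (Nat.pow_gt_lin_r 2 b ltac:(lia)). lia. }
      unfold tR. clear - HX Hbx. nra. }
    op.
    apply (brute_force_loop K _ _ _ (wl + 4) (n 6%nat) l (length l) 0); reg; auto.
    { apply HC3. }
    { frame. }
    2: { fold x. assert (Hcx : (8 * INR n0 + 2000 * X) * x <= c * phi (length l)).
         { pose proof (pos_INR n0). apply Rmult_le_compat; lra. }
         assert (x * x <= INR n0 * x) by (apply Rmult_le_compat_r; lra).
         assert (x <= X * x) by (clear - HX Hx1; nra). lra. }
    intros n' r' Ha Hat' Hle Hmin. peel Ha.
    assert (HC' : constants n').
    { destruct HC3 as (D0 & D1 & D2 & D3 & D5 & D27 & D28).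
      repeat split; rewrite Ha by off; auto. }
    apply (pop K c _ _ _ (n 6%nat) Q); auto.
    + intros. eapply IH; eauto.
    + rewrite Ha by off. exact G6.
    + rewrite Ha by off. exact G7.
    + apply (queue_ext n3); auto. intros a Hla. apply Ha. off.
    + destruct HP as [HP | (l' & x' & y' & Hl' & Hx' & Hy' & Hxy & Hm)].
      { left. eapply attained_le_closest; eauto. }
      destruct Hl' as [<- | Hl']; [| right; exists l', x', y'; auto].
      left. split; [exact Hat' |]. intros a a' Hal Hal' Haa.
      apply Rle_trans with (dist x' y'); [| auto].
      destruct (In_nth _ _ O Hx') as (i & Hi & <-).
      destruct (In_nth _ _ O Hy') as (j & Hj & <-).
      (* Brute force queries only pairs whose first index is larger; symmetry gives the others. *)
      destruct (Nat.lt_trichotomy i j) as [Hij | [-> | Hij]].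
      * destruct metric as (_ & _ & Hsym & _). rewrite Hsym by auto. apply Hmin; lia.
      * contradiction.
      * apply Hmin; lia.
    + apply Rle_refl.
Qed.

Lemma closest_pair_pending : (2 <= N)%nat -> pending [seq 0 N].
Proof.
  intro HN.
  destruct (minimiser (fun a => dist (fst a) (snd a))
    (fun a => negb (fst a =? snd a)%nat) (list_prod (seq 0 N) (seq 0 N)))
    as ((x & y) & Hin & Hxy & Hmin).
  { exists (0, 1)%nat. split; [| reflexivity]. apply in_prod; apply in_seq; lia. }
  apply in_prod_iff in Hin. cbn [fst snd] in *.
  apply Bool.negb_true_iff, Nat.eqb_neq in Hxy.
  exists (seq 0 N), x, y. repeat split; try tauto; [left; reflexivity |].
  intros a b Ha Hb Hab. apply (Hmin (a, b)); cbn [fst snd].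
  - apply in_prod; apply in_seq; lia.
  - apply Bool.negb_true_iff, Nat.eqb_neq, Hab.
Qed.

Lemma total_cost K n r v d D :
  (2 <= N)%nat -> L = (2 ^ D)%nat ->
  (forall i, (i < D)%nat -> INR i < d) -> d <= INR D ->
  n 0%nat = N -> r O = d ->
  c * phi N + 5 * INR N + 5 * INR D + 26 <= v ->
  cost K 0 n r v.
Proof.
  intros HN HL HD1 HD2 H0 Hr Hv.
  op. op. op. op.
  apply (dimension_loop K _ _ _ (v - 7 - 5 * INR D) d D D 0); reg; auto; [| lra].
  intros n1 r1 Hn1 E3. rewrite <- HL in E3.
  assert (E0 : n1 0%nat = N) by (rewrite Hn1 by off; reg; auto).
  assert (E1 : n1 1%nat = 1%nat) by (rewrite Hn1 by off; reg; auto).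
  assert (E2 : n1 2%nat = 2%nat) by (rewrite Hn1 by off; reg; auto).
  clear n r Hn1 H0 Hr.
  assert (HM : M = (32 + N)%nat) by reflexivity.
  op. op. op. op. op. op. op. op. op. op. op.
  rewrite E0, E1, E3, Nat.mul_1_r. fold M.
  op. op. rewrite E1.
  apply (fill_loop K _ _ _ (c * phi N + 4) M N 0); reg; auto; try lra.
  { intros i Hi. inversion Hi. }
  intros n2 Hn2 Harr.
  (* The answer starts as the distance of points 0 and 1, the constant register serving as index. *)
  op. op. rewrite Hn2 by off. reg. rewrite E1, oracle_in by lia.
  assert (Hphi : phi (length (seq 0 N)) = phi N) by (rewrite length_seq; reflexivity).
  apply (main_loop K _ _ _ M [seq 0 N]); [| cbn [weight]; rewrite Hphi; lra].
  assert (HV : valid (seq 0 N)).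
  { split; [apply seq_NoDup | split].
    - intros x Hx. apply in_seq in Hx. lia.
    - rewrite length_seq. lia. }
  assert (HL4 : (L ^ 4 = L * L * (L * L))%nat) by (simpl; ring).
  assert (HC : constants n2).
  { repeat split; rewrite Hn2 by off; reg; auto; rewrite HL4; ring. }
  repeat split; reg; auto.
  1-7: apply HC.
  - rewrite Hn2 by off. reg.
  - rewrite Hn2 by off. reg. cbn [length]. lia.
  - rewrite Hn2, length_seq by off. reg.
  - exists 0%nat, 1%nat. repeat split; auto; lia.
  - right. apply closest_pair_pending, HN.
Qed.

End Costs.

End Program.

(** * From the dimension to the final bound *)

Lemma least_nat_above d : exists D, d <= INR D /\ forall i, (i < D)%nat -> INR i < d.
Proof.
  assert (H : forall n, d <= INR n -> exists D, d <= INR D /\ forall i, (i < D)%nat -> INR i < d).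
  { induction n as [|n IH]; intro Hn.
    - exists O. split; [exact Hn | intros i Hi; lia].
    - destruct (Rle_lt_dec d (INR n)) as [H|H]; [auto |].
      exists (S n). split; [exact Hn |]. intros i Hi.
      eapply Rle_lt_trans; [apply le_INR | exact H]. lia. }
  destruct (INR_unbounded d) as (n & Hn). apply (H n). lra.
Qed.

Lemma doubling_constant_le N dist d D lam :
  (1 <= N)%nat -> doubling_covers N dist lam -> d = ln (INR lam) / ln 2 -> d <= INR D ->
  (lam <= 2 ^ D)%nat.
Proof.
  intros HN Hcov Hd HD.
  destruct lam as [|lam]; [lia |].
  apply INR_le. rewrite pow_INR. change (INR 2) with 2.
  assert (Hln2 : 0 < ln 2) by (rewrite <- ln_1; apply ln_increasing; lra).
  assert (Hl : 0 < INR (S lam)) by (apply lt_0_INR; lia).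
  assert (H2D : 0 < 2 ^ D) by (apply pow_lt; lra).
  apply Rnot_lt_le. intro Hlt.
  apply ln_increasing in Hlt; auto. rewrite ln_pow in Hlt by lra.
  assert (d * ln 2 = ln (INR (S lam))) by (rewrite Hd; field; lra). nra.
Qed.

Theorem theorem1 :
  exists prog : list instr,
    forall d : R, exists C : R,
      forall (N : nat) (dist : nat -> nat -> R),
        (2 <= N)%nat ->
        is_metric N dist ->
        doubling_dimension N dist d ->
        (* Las Vegas correctness: whenever it halts, the output RM[0] is right *)
        (forall l : list bool,
           halted prog (final_config prog N dist d l) = true ->
           is_closest_pair_distance N dist (rmem (final_config prog N dist d l) 0)) /\
        (* expected running time  E[T] = sum_k Pr[T > k]  <=  C N log N *)
        (forall K : nat,
           psum (prob_time_gt prog N dist d) K <= C * INR N * ln (INR N)).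
Proof.
  exists closest_pair. intro d.
  destruct (least_nat_above d) as (D & HD1 & HD2).
  destruct (brute_force_bound D) as (n0 & Hn0).
  set (L := (2 ^ D)%nat) in *.
  set (c := 8000000 * INR L ^ 16 + 8 * INR n0 + 2000 * INR L ^ 4).
  (* The first factor absorbs 5 N + 5 D + 26 into [phi N], which is at least N; the second turns
     [phi N] into N ln N, as N is at least 2. *)
  exists ((c + 5 * INR D + 31) * (1 + / ln 2)).
  intros N dist HN Hmet (lam & (Hcov & _) & Hd).
  assert (HL : (1 <= L)%nat) by (apply Nat.neq_0_lt_0, Nat.pow_nonzero; lia).
  assert (Hcov' : doubling_covers N dist L).
  { apply (doubling_covers_mono _ _ lam); auto.
    apply (doubling_constant_le N dist d); auto; lia. }
  assert (Hcost : forall K, ecost closest_pair (oracle N dist)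
    (is_closest_pair_distance N dist) K (init_config N d)
    (c * phi N + 5 * INR N + 5 * INR D + 26)).
  { intro K. apply (total_cost N dist L c n0 Hmet Hcov' HL Hn0 (Rle_refl c)
      K _ _ _ d D); auto. apply Rle_refl. }
  split.
  - intros l Hl. exact (ecost_correct _ _ _ l _ _ (Hcost _) Hl).
  - intro K. eapply Rle_trans; [exact (ecost_expectation _ _ _ K _ _ (Hcost K)) |].
    assert (HN2 : 2 <= INR N) by (apply (le_INR 2), HN).
    assert (Hln2 : 0 < ln 2) by (rewrite <- ln_1; apply ln_increasing; lra).
    assert (HlnN : ln 2 <= ln (INR N)) by (apply ln_monotone; lra).
    assert (Hc : 0 <= c).
    { pose proof (pos_INR n0). pose proof (pow_le _ 16 (pos_INR L)).
      pose proof (pow_le _ 4 (pos_INR L)). unfold c. lra. }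
    assert (HD : 0 <= INR D) by apply pos_INR.
    assert (Hphi : phi N <= INR N * ln (INR N) * (1 + / ln 2)).
    { unfold phi. rewrite Rmult_assoc. apply Rmult_le_compat_l; [lra |].
      rewrite Rmult_plus_distr_l.
      assert (1 <= ln (INR N) * / ln 2); [| lra].
      rewrite <- (Rinv_r (ln 2)) by lra. apply Rmult_le_compat_r; [| exact HlnN].
      apply Rlt_le, Rinv_0_lt_compat, Hln2. }
    assert (HNphi : INR N <= phi N) by (apply phi_ge; lia).
    apply Rle_trans with ((c + 5 * INR D + 31) * phi N); [nra |].
    apply (Rmult_le_compat_l (c + 5 * INR D + 31)) in Hphi; lra.
Qed.
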